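(* Let $N\ge1$ and $Z_N=Z(\mathrm U(\mathfrak q_N))$. Let $c_{2r-1}\in Z_N$ ($r\ge1$) be Sergeev's odd cyclic elements, and write the one-row Capelli series as $\mathcal D_N(u)=\sum_{r\ge0}\frac{D_r}{(u\downarrow r)}=1+\sum_{n\ge1}\alpha_nu^{-n}$ with $\alpha_n\in Z_N$; equivalently, $\alpha_n=\sum_{j=1}^nS(n-1,j-1)D_j$ for $n\ge1$, where $S(\cdot,\cdot)$ are Stirling numbers of the second kind. Then, for every $r\ge1$, the following $(N+1)\times(N+1)$ determinant identities hold in $Z_N$: $$\det\bigl(c_{2(r+i+j)-1}\bigr)_{0\le i,j\le N}=0,\qquad \det\bigl(\alpha_{r+i+j}\bigr)_{0\le i,j\le N}=0.$$
   Context: Ground field $\mathbb C$. Queer Lie superalgebra: fix $N\ge1$, $I_N=\{-N,\dots,-1,1,\dots,N\}$, $\bar i=0$ if $i>0$ and $\bar i=1$ if $i<0$. Let $E_{ij}$ ($i,j\in I_N$) be the matrix units of $\mathfrak{gl}(N|N)$, of parity $\bar i+\bar j$ mod $2$. $\mathfrak q_N\subset\mathfrak{gl}(N|N)$ is the Lie sub-superalgebra spanned by $F_{ij}=E_{ij}+E_{-i,-j}$ (so $F_{-i,-j}=F_{ij}$). $\mathrm U(\mathfrak q_N)$ is its universal enveloping algebra and $Z_N=Z(\mathrm U(\mathfrak q_N))$ its center (in the superalgebra sense; all central elements are even). Harish-Chandra map: $\mathfrak h_{\bar0}=\bigoplus_{i=1}^N\mathbb C F_{ii}$, $\mathfrak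 h_{\bar 1}=\bigoplus_{i=1}^N\mathbb C F_{i,-i}$, $\mathfrak n_+$ (resp. $\mathfrak n_-$) is the span of $F_{ij},F_{i,-j}$ with $1\le i<j\le N$ (resp. $1\le j<i\le N$). For $z\in Z_N$, $\mathrm{HC}(z)\in\mathbb C[\lambda_1,\dots,\lambda_N]$ is the polynomial with $z\equiv \mathrm{HC}(z)|_{\lambda_i=F_{ii}}$ modulo $\mathfrak n_-\mathrm U(\mathfrak q_N)+\mathrm U(\mathfrak q_N)\mathfrak n_+$ (no $\rho$-shift). It is known that $\mathrm{HC}$ is an algebra isomorphism of $Z_N$ onto $\Gamma_N$, the algebra of symmetric polynomials $f\in\mathbb C[\lambda_1,\dots,\lambda_N]$ such that $f(t,-t,\lambda_3,\dots,\lambda_N)$ is independent of $t$ (no condition if $N=1$). Cyclic elements: for $r\ge1$, $$c_r=\sum_{i_1,\dots,i_r\in I_N}(-1)^{\bar i_2+\cdots+\bar i_r}F_{i_1i_2}F_{i_2i_3}\cdots F_{i_ri_1}\in \mathrm U(\mathfrak q_N);$$ these are known to be central. Normalized one-row Capelli elements: $(u\downarrow r)=u(u-1)\cdots(u-r+1)$, $(u\downarrow0)=1$. Let $Q^-_{(0)}=1$ and for $r\ge1$ let $Q^-_{(r)}\in\Gamma_N$ be the one-row factorial Schur $Q$-polynomial $Q^-_{(r)}(\lambda)=2\sum_{i=1}^N(\lambda_i\downarrow r)\prod_{j\ne i}\frac{\lambda_i+\lambda_j}{\lambda_i-\lambda_j}$; equivalently $\sum_{r\ge0}Q^-_{(r)}(\lambda)/(u\downarrow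 r)=\prod_{i=1}^N\frac{u+1+\lambda_i}{u+1-\lambda_i}$ as series in $u^{-1}$. Then $D_0=1$ and $D_r=\frac1{r!}C_{(r)}$ for $r\ge1$, where $C_{(r)}$ is Nazarov's Capelli element of the one-row strict partition $(r)$; $D_r$ is the unique element of $Z_N$ with $\mathrm{HC}(D_r)=Q^-_{(r)}$. The series $\mathcal D_N(u)$ is expanded at $u=\infty$ in $Z_N[[u^{-1}]]$. Stirling numbers: $S(n,r)$ is the number of partitions of $\{1,\dots,n\}$ into $r$ nonempty blocks, with $S(0,0)=1$, $S(n,0)=0$ for $n>0$, $S(n,r)=0$ if $r<0$ or $r>n$. *)

(* Defs.v *)
From HB Require Import structures.
From mathcomp Require Import all_boot all_order all_algebra.
From mathcomp Require Import generic_quotient ring_quotient.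
From mathcomp Require Import boolp reals complex.
From mathcomp Require Import mpoly.
From mathcomp Require Import -(notations) monalg.

Set Implicit Arguments.
Unset Strict Implicit.
Unset Printing Implicit Defensive.

Import GRing.Theory.

Local Open Scope ring_scope.
Local Open Scope quotient_scope.

Section FreeAlgebra.
Variables (K : comNzRingType) (T : choiceType).

Definition free_alg := malg (fmonom T) K.
HB.instance Definition _ := GRing.Lalgebra.on free_alg.

Definition free_gen (x : T) : free_alg := mkmalgU (fmu x) 1.

Lemma free_mulC (k : K) (x : free_alg) :
  x * (mkmalgU mone k : free_alg) = k *: x.
Proof.
rewrite [LHS]malgM_def malgZ_def fgmulgU; apply/eq_bigr => m _.
by rewrite mulm1 mulrC.
Qed.

Lemma free_scaleAr (k : K) (x y : free_alg) : k *: (x * y) = x * (k *: y).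
Proof.
rewrite scalerAl -[k *: x]free_mulC -[LHS]mulrA; congr (_ * _).
by rewrite [LHS]mul_malgC.
Qed.

HB.instance Definition _ := GRing.Lalgebra_isAlgebra.Build K free_alg
  free_scaleAr.

Definition free_counit : free_alg -> K := @mcoeff _ K mone.

Lemma free_counit_zmod : zmod_morphism free_counit.
Proof. exact: (raddfB (@mcoeff _ K mone)). Qed.

Lemma free_counit_monoid : monoid_morphism free_counit.
Proof.
split; first exact: (rmorph1 (@mcoeff _ K mone)).
exact: (rmorphM (@mcoeff _ K mone)).
Qed.

Lemma free_counit_scale : scalable_for *%R free_counit.
Proof. by move=> k x; exact: mcoeffZ. Qed.

HB.instance Definition _ :=
  GRing.isZmodMorphism.Build free_alg K free_counit free_counit_zmod.
HB.instance Definition _ :=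
  GRing.isMonoidMorphism.Build free_alg K free_counit free_counit_monoid.
HB.instance Definition _ :=
  GRing.isScalable.Build K free_alg K *%R free_counit free_counit_scale.

Lemma free_counit_gen x : free_counit (free_gen x) = 0.
Proof. by rewrite /free_counit mcoeffU fm1_eq1. Qed.

End FreeAlgebra.

Section TwoSidedIdeal.
Variables (K : comNzRingType) (A : algType K) (rel : A -> Prop).

(* The two-sided ideal of A generated by rel. *)
Inductive ideal : A -> Prop :=
| ideal_rel f : rel f -> ideal f
| ideal0 : ideal 0
| idealD f g : ideal f -> ideal g -> ideal (f + g)
| idealMl f g : ideal g -> ideal (f * g)
| idealMr f g : ideal f -> ideal (f * g).

Definition in_ideal : {pred A} := fun f => `[< ideal f >].

Lemma in_idealP f : reflect (ideal f) (f \in in_ideal).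
Proof. exact: asboolP. Qed.

Lemma ideal_zmod_closed : zmod_closed in_ideal.
Proof.
split=> [|f g /in_idealP If /in_idealP Ig]; apply/in_idealP.
  exact: ideal0.
by apply: idealD => //; rewrite -mulN1r; apply: idealMl.
Qed.

HB.instance Definition _ :=
  GRing.isZmodClosed.Build A in_ideal ideal_zmod_closed.

Lemma ideal_mull f g : g \in in_ideal -> f * g \in in_ideal.
Proof. by move=> /in_idealP Ig; apply/in_idealP/idealMl. Qed.

Lemma ideal_mulr f g : f \in in_ideal -> f * g \in in_ideal.
Proof. by move=> /in_idealP If; apply/in_idealP/idealMr. Qed.

Lemma ideal_proper (eps : {rmorphism A -> K}) :
  (forall f, rel f -> eps f = 0) -> 1 \notin in_ideal.
Proof.
move=> rel0; suff ideal_eps f : ideal f -> eps f = 0.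
  by apply/in_idealP => /ideal_eps/eqP; rewrite rmorph1 oner_eq0.
elim=> {f} [f /rel0//||f g _ ef _ eg|f g _ eg|f g _ ef].
- exact: rmorph0.
- by rewrite rmorphD ef eg addr0.
- by rewrite rmorphM eg mulr0.
- by rewrite rmorphM ef mul0r.
Qed.

End TwoSidedIdeal.

Section CounitRelations.
Variables (K : comNzRingType) (A : algType K) (eps : {rmorphism A -> K}).
Hypothesis epsZ : forall k x, eps (k *: x) = k * eps x.

Lemma eps_linear k x y z : eps x = 0 -> eps y = 0 -> eps z = 0 ->
  eps (x - (k *: y + z)) = 0.
Proof.
by move=> ex ey ez; rewrite rmorphB rmorphD epsZ ex ey ez /= mulr0 addr0 subr0.
Qed.

Lemma eps_bracket k x y z : eps x = 0 -> eps y = 0 -> eps z = 0 ->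
  eps (x * y - k *: (y * x) - z) = 0.
Proof.
move=> ex ey ez; rewrite !rmorphB epsZ !rmorphM ex ey ez /=.
by rewrite !mulr0 !subr0.
Qed.

End CounitRelations.

Section AlgebraQuotient.
Variables (K : comNzRingType) (A : algType K) (I : zmodClosed A).
Hypothesis I_mull : forall x y, y \in I -> x * y \in I.
Hypothesis I_mulr : forall x y, x \in I -> x * y \in I.

Local Notation Q := (Quotient.quot I).

Definition quot_one : Q := lift_cst Q 1.
Definition quot_mul := lift_op2 Q *%R.
Definition quot_scale (k : K) := lift_op1 Q ( *:%R k).

Canonical pi_quot_one_morph := PiConst quot_one.

Lemma quot_repr x : x - repr (\pi_Q x) \in I.
Proof. by rewrite Quotient.idealrBE reprK. Qed.

Lemma pi_quot_mul : {morph \pi_Q : x y / x * y >-> quot_mul x y}.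
Proof.
move=> x y; unlock quot_mul; apply/eqP; rewrite -Quotient.idealrBE.
have -> : x * y - repr (\pi_Q x) * repr (\pi_Q y) =
    (x - repr (\pi_Q x)) * y + repr (\pi_Q x) * (y - repr (\pi_Q y)).
  by rewrite mulrBl mulrBr addrA subrK.
by apply: rpredD; [apply: I_mulr | apply: I_mull]; apply: quot_repr.
Qed.
Canonical pi_quot_mul_morph := PiMorph2 pi_quot_mul.

Lemma pi_quot_scale k : {morph \pi_Q : x / k *: x >-> quot_scale k x}.
Proof.
move=> x; unlock quot_scale; apply/eqP; rewrite -Quotient.idealrBE.
by rewrite -scalerBr -[X in k *: X]mul1r scalerAl; apply/I_mull/quot_repr.
Qed.
Canonical pi_quot_scale_morph k := PiMorph1 (pi_quot_scale k).

Lemma quot_mulA : associative quot_mul.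
Proof. by move=> x y z; rewrite -[x]reprK -[y]reprK -[z]reprK !piE mulrA. Qed.

Lemma quot_mul1 : left_id quot_one quot_mul.
Proof. by move=> x; rewrite -[x]reprK !piE mul1r. Qed.

Lemma quot_mulr1 : right_id quot_one quot_mul.
Proof. by move=> x; rewrite -[x]reprK !piE mulr1. Qed.

Lemma quot_mulDl : left_distributive quot_mul +%R.
Proof.
by move=> x y z; rewrite -[x]reprK -[y]reprK -[z]reprK !piE mulrDl.
Qed.

Lemma quot_mulDr : right_distributive quot_mul +%R.
Proof.
by move=> x y z; rewrite -[x]reprK -[y]reprK -[z]reprK !piE mulrDr.
Qed.

Lemma quot_one_neq0 : 1 \notin I -> quot_one != 0.
Proof. by rewrite !piE Quotient.equivE subr0. Qed.

Lemma quot_scaleA a b x :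
  quot_scale a (quot_scale b x) = quot_scale (a * b) x.
Proof. by rewrite -[x]reprK !piE scalerA. Qed.

Lemma quot_scale1 : left_id 1 quot_scale.
Proof. by move=> x; rewrite -[x]reprK !piE scale1r. Qed.

Lemma quot_scaleDr : right_distributive quot_scale +%R.
Proof. by move=> a x y; rewrite -[x]reprK -[y]reprK !piE scalerDr. Qed.

Lemma quot_scaleDl x : {morph quot_scale^~ x : a b / a + b}.
Proof. by move=> a b; rewrite -[x]reprK !piE scalerDl. Qed.

Lemma quot_scaleAl k x y :
  quot_scale k (quot_mul x y) = quot_mul (quot_scale k x) y.
Proof. by rewrite -[x]reprK -[y]reprK !piE scalerAl. Qed.

Lemma quot_scaleAr k x y :
  quot_scale k (quot_mul x y) = quot_mul x (quot_scale k y).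
Proof. by rewrite -[x]reprK -[y]reprK !piE scalerAr. Qed.

End AlgebraQuotient.

(* The index set {-N, .., -1, 1, .., N} is 'I_(N + N): the index k.+1 is
   [lshift N k] and the index - k.+1 is [rshift N k]. *)
Definition ipos (N : nat) (k : 'I_N) : 'I_(N + N) := lshift N k.

Definition iopp (N : nat) (i : 'I_(N + N)) : 'I_(N + N) :=
  match split i with inl k => rshift N k | inr k => lshift N k end.

Definition ipar (N : nat) (i : 'I_(N + N)) : bool := (N <= i)%N.

Section Queer.
Variables (K : fieldType) (N : nat).

Local Notation gl := 'M[K]_(N + N).

Definition Fmx (i j : 'I_(N + N)) : gl :=
  delta_mx i j + delta_mx (iopp i) (iopp j).

Definition queer : {vspace gl} := (\sum_i \sum_j <[Fmx i j]>)%VS.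

Lemma mem_Fmx i j : Fmx i j \in queer.
Proof.
by rewrite memvE (subv_trans _ (sumv_sup i _ (sumv_sup j _ (subvv _)))).
Qed.

Definition gl_parity (b : bool) (A : gl) : Prop :=
  forall i j, A i j != 0 -> ipar i (+) ipar j = b.

(* The supercommutator of A and B of respective parities a and b. *)
Definition gl_bracket (a b : bool) (A B : gl) : gl :=
  A *m B - (-1) ^+ (a && b) *: (B *m A).

Local Notation tensor := (free_alg K (subvs_of queer)).
Local Notation gen := (@free_gen K (subvs_of queer)).

(* U(q_N) is the quotient of the free associative algebra on the set q_N by the
   two-sided ideal generated by linearity and the supercommutation relations. *)
Inductive Urel : tensor -> Prop :=
| Urel_linear k x y : Urel (gen (k *: x + y) - (k *: gen x + gen y))
| Urel_bracket a b x y z :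
    gl_parity a (vsval x) -> gl_parity b (vsval y) ->
    vsval z = gl_bracket a b (vsval x) (vsval y) ->
    Urel (gen x * gen y - (-1) ^+ (a && b) *: (gen y * gen x) - gen z).

Lemma Urel_counit f : Urel f -> free_counit f = 0.
Proof.
case=> [k x y|a b x y z _ _ _].
  by apply: (eps_linear (@free_counit_scale K _)); apply: free_counit_gen.
by apply: (eps_bracket (@free_counit_scale K _)); apply: free_counit_gen.
Qed.

Lemma Urel_proper : 1 \notin in_ideal Urel.
Proof. exact: (ideal_proper Urel_counit). Qed.

Definition Uq := Quotient.quot (in_ideal Urel : zmodClosed tensor).

Local Notation mull := (@ideal_mull K tensor Urel).
Local Notation mulr := (@ideal_mulr K tensor Urel).

HB.instance Definition _ := GRing.Zmodule.on Uq.
HB.instance Definition _ := EqQuotient.on Uq.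

HB.instance Definition _ := GRing.Zmodule_isNzRing.Build Uq
  (quot_mulA mull mulr) (quot_mul1 mull mulr)
  (quot_mulr1 mull mulr) (quot_mulDl mull mulr)
  (quot_mulDr mull mulr) (quot_one_neq0 Urel_proper).

HB.instance Definition _ := GRing.Zmodule_isLmodule.Build K Uq
  (quot_scaleA mull) (quot_scale1 mull)
  (quot_scaleDr mull) (quot_scaleDl mull).

HB.instance Definition _ := GRing.Lmodule_isLalgebra.Build K Uq
  (quot_scaleAl mull mulr).

HB.instance Definition _ := GRing.Lalgebra_isAlgebra.Build K Uq
  (quot_scaleAr mull mulr).

Definition iota_q (x : subvs_of queer) : Uq := \pi_Uq (gen x).

Definition Fgen (i j : 'I_(N + N)) : Uq := iota_q (Subvs (mem_Fmx i j)).

(* The Z/2-grading of U(q_N). *)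
Inductive Uparity : bool -> Uq -> Prop :=
| Uparity0 b : Uparity b 0
| Uparity1 : Uparity false 1
| Uparity_gen b x : gl_parity b (vsval x) -> Uparity b (iota_q x)
| UparityD b x y : Uparity b x -> Uparity b y -> Uparity b (x + y)
| UparityZ b k x : Uparity b x -> Uparity b (k *: x)
| UparityM b c x y : Uparity b x -> Uparity c y -> Uparity (b (+) c) (x * y).

Definition supercentral (z : Uq) : Prop :=
  exists z0 z1 : Uq,
    [/\ z = z0 + z1, Uparity false z0, Uparity true z1 &
        forall b y, Uparity b y ->
          z0 * y = y * z0 /\ z1 * y = (-1) ^+ b *: (y * z1)].

(* Membership in n_- U(q_N) + U(q_N) n_+. *)
Definition HC_null (x : Uq) : Prop :=
  exists a b c d : 'I_N -> 'I_N -> Uq,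
    x = \sum_(i < N) \sum_(j < N | (j < i)%N)
          (Fgen (ipos i) (ipos j) * a i j
           + Fgen (ipos i) (iopp (ipos j)) * b i j)
      + \sum_(i < N) \sum_(j < N | (i < j)%N)
          (c i j * Fgen (ipos i) (ipos j)
           + d i j * Fgen (ipos i) (iopp (ipos j))).

(* p is the Harish-Chandra image of z, without rho-shift. *)
Definition is_HC (z : Uq) (p : {mpoly K[N]}) : Prop :=
  HC_null
    (z - mpoly.mmap (fun k => k%:A) (fun i => Fgen (ipos i) (ipos i)) p).

(* The summation index (i_1, .., i_r) is the function k |-> i_(k.+1); the
   successor [ordS] is cyclic, so the last factor is Fgen i_r i_1. *)
Definition cyclic_elt (r : nat) : Uq :=
  \sum_(i : {ffun 'I_r -> 'I_(N + N)})
    (-1) ^+ (\sum_(k < r | (0 < k)%N) ipar (i k))%N *: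
    \prod_(k < r) Fgen (i k) (i (ordS k)).

Definition falling (A : pzRingType) (x : A) (r : nat) : A :=
  \prod_(k < r) (x - k%:R).

(* p is the one-row factorial Schur Q-polynomial of index r >= 1; the defining
   identity is read in the field of rational functions. *)
Definition is_Qrow (r : nat) (p : {mpoly K[N]}) : Prop :=
  let x (i : 'I_N) : {fraction {mpoly K[N]}} := tofrac 'X_i in
  tofrac p = 2 * \sum_(i < N) falling (x i) r *
                   \prod_(j < N | j != i) ((x i + x j) / (x i - x j)).

(* D is the family of normalized one-row Capelli elements. *)
Definition is_capelli (D : nat -> Uq) : Prop :=
  D 0%N = 1 /\
  forall r, (0 < r)%N ->
    supercentral (D r) /\ exists2 p, is_Qrow r p & is_HC (D r) p.

(* Power series in u^-1 are coefficient sequences. *)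
Definition ser_one (n : nat) : K := (n == 0%N)%:R.

Definition ser_mul (a b : nat -> K) (n : nat) : K :=
  \sum_(k < n.+1) a k * b (n - k)%N.

(* 1 / (u - k) = \sum_(m >= 0) k ^ m u ^ (- m - 1) *)
Definition ser_inv_lin (k n : nat) : K :=
  if n is m.+1 then k%:R ^+ m else 0.

Definition ser_inv_falling (r : nat) : nat -> K :=
  \big[ser_mul/ser_one]_(k < r) ser_inv_lin k.

(* The coefficient of u^-n in \sum_r D r / falling u r; as 1 / falling u r has
   order r in u^-1, only the terms with r <= n contribute. *)
Definition capelli_coef (D : nat -> Uq) (n : nat) : Uq :=
  \sum_(r < n.+1) ser_inv_falling r n *: D r.

End Queer.

Definition stirling2 (n r : nat) : nat :=
  #|[set P : {set {set 'I_n}} | partition P [set: 'I_n] & #|P| == r]|.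

(* Main.v *)
(* A central element of U(q_N) is determined by its action on highest weight
   vectors.  Let W be the natural module extended by a trivial summand.  The
   modules W^(x)n, n >= 0, are jointly faithful: a linear map built from a
   projection of End W onto q_N that kills 1 sends the image in W^(x)n of a word
   of length n to n! times that word modulo shorter words, and kills shorter
   words.  For the standard Hermitian form, F_ij and F_ji act on W^(x)n by
   adjoint operators, so central elements act by normal operators, and a central
   element killing every highest weight vector is zero.

   On a highest weight vector of weight lambda, c_(2q+1) acts by the scalar
   2 lambda^T T^q (1, .., 1)^T, where T is the upper triangular N x N matrix with
   diagonal entries lambda_i (lambda_i - 1) and entries - 2 lambda_j above the
   diagonal, and alpha_(m+1) acts by
   2 sum_i lambda_i (lambda_i - 1)^m prod_(j <> i) (lambda_i + lambda_j) / (lambda_i - lambda_j).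
   In both cases the Hankel matrix of size N + 1 factors through dimension N. *)
From HB Require Import structures.
From mathcomp Require Import all_boot all_order all_algebra.
From mathcomp Require Import generic_quotient ring_quotient ssrAC.
From mathcomp Require Import boolp reals complex finmap.
From mathcomp Require Import mpoly.
From mathcomp Require Import -(notations) monalg.
From mathcomp Require Import mxtens ring.
Require Import Defs.

Set Implicit Arguments.
Unset Strict Implicit.
Unset Printing Implicit Defensive.

Import GRing.Theory Num.Theory.
Local Open Scope ring_scope.
Local Open Scope quotient_scope.

(** Neither the Poincare-Birkhoff-Witt theorem nor injectivity of the Harish-Chandra map is taken
    for granted: joint faithfulness of the W^(x)n, which carry a Hermitian form, replaces both. The
    highest weight vectors of one weight need not form a line, so a central element is not known in
    advance to act on them by a scalar. For the cyclic elements the scalar is computed; for z = D_r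
    with Harish-Chandra image p, the vector z w - p(lambda) w is shown to be orthogonal to itself.

    The weights met in W^(x)n consist of natural numbers and may have equal entries, where the
    quotient formula for alpha_(m+1) makes no sense. Its Hankel determinant is therefore shown to
    vanish as a rational function, hence as a polynomial, and only then evaluated at lambda; T has
    polynomial entries and needs no such detour.

    T is the effect of two successive multiplications by the matrix of the F_ij: the F_(i,-i) need
    not act by scalars, but they square to F_ii. *)

Section FreeLift.
Variables (K : comNzRingType) (T : choiceType) (d : nat) (phi : T -> 'M[K]_d).

Definition free_lift_monom (m : fmonom T) : 'M[K]_d := \prod_(x <- m) phi x.

(** Universal property of the free algebra, for matrix targets only: this is all that the
    representations on tensor powers require. *)
Definition free_lift (g : free_alg K T) : 'M[K]_d :=
  \sum_(m <- monalg.msupp g) monalg.mcoeff m g *: free_lift_monom m.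

Lemma free_liftEw (D : {fset fmonom T}) (g : free_alg K T) :
  (monalg.msupp g `<=` D)%fset ->
  free_lift g = \sum_(m <- D) monalg.mcoeff m g *: free_lift_monom m.
Proof.
move=> le; rewrite [LHS](big_fset_incl _ le) //= => m _ /monalg.mcoeff_outdom ->.
by rewrite scale0r.
Qed.

Lemma free_lift_linear k (g h : free_alg K T) :
  free_lift (k *: g + h) = k *: free_lift g + free_lift h.
Proof.
pose D := (monalg.msupp g `|` (monalg.msupp h `|`
  monalg.msupp (k *: g + h : monalg.malg _ _)))%fset.
have Dg : (monalg.msupp g `<=` D)%fset by rewrite /D fsubsetUl.
have Dh : (monalg.msupp h `<=` D)%fset by rewrite /D fsetUCA fsubsetUl.
have Dkgh : (monalg.msupp (k *: g + h : monalg.malg _ _) `<=` D)%fset.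
  by rewrite /D fsetUA fsubsetUr.
rewrite (free_liftEw Dg) (free_liftEw Dh) (free_liftEw Dkgh).
rewrite scaler_sumr -big_split; apply: eq_bigr => m _ /=.
by rewrite monalg.mcoeffD monalg.mcoeffZ scalerDl scalerA.
Qed.

Lemma free_lift0 : free_lift 0 = 0.
Proof. by rewrite /free_lift monalg.msupp0 big_seq_fset0. Qed.

Lemma free_liftD g h : free_lift (g + h) = free_lift g + free_lift h.
Proof. by rewrite -[g]scale1r free_lift_linear !scale1r. Qed.

Lemma free_liftZ k g : free_lift (k *: g) = k *: free_lift g.
Proof. by rewrite -[k *: g]addr0 free_lift_linear free_lift0 addr0. Qed.

Lemma free_lift_sum (I : Type) (r : seq I) (P : pred I) (F : I -> free_alg K T) :
  free_lift (\sum_(i <- r | P i) F i) = \sum_(i <- r | P i) free_lift (F i).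
Proof. exact: (big_morph free_lift free_liftD free_lift0). Qed.

Lemma free_liftU c m :
  free_lift (mkmalgU m c) = c *: free_lift_monom m.
Proof.
by rewrite (free_liftEw (@monalg.msuppU_le _ _ _ _)) big_seq_fset1 monalg.mcoeffUU.
Qed.

Lemma free_lift1 : free_lift 1 = 1.
Proof.
rewrite [X in free_lift X](_ : _ = mkmalgU mone 1) //.
by rewrite free_liftU scale1r /free_lift_monom fm1 big_nil.
Qed.

Lemma free_lift_gen x : free_lift (free_gen K x) = phi x.
Proof. by rewrite free_liftU scale1r /free_lift_monom fmU big_seq1. Qed.

Lemma free_liftM (g h : free_alg K T) : free_lift (g * h) = free_lift g * free_lift h.
Proof.
transitivity (free_lift (\sum_(m <- monalg.msupp g) \sum_(n <- monalg.msupp h)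
    (mkmalgU (mmul m n) (monalg.mcoeff m g * monalg.mcoeff n h) : free_alg K T))).
  by congr free_lift; rewrite [LHS]malgME.
rewrite free_lift_sum [free_lift g]/free_lift mulr_suml.
apply: eq_bigr => m _; rewrite free_lift_sum [free_lift h]/free_lift mulr_sumr.
apply: eq_bigr => n _.
rewrite free_liftU /free_lift_monom fmM big_cat /= -!mulmxE.
by rewrite -scalemxAl -scalemxAr scalerA.
Qed.

Lemma free_liftB (g h : free_alg K T) : free_lift (g - h) = free_lift g - free_lift h.
Proof. by rewrite -scaleN1r free_liftD free_liftZ scaleN1r. Qed.

Lemma free_lift_bracket c (f g h : free_alg K T) :
  free_lift (f * g - c *: (g * f) - h) =
  free_lift f *m free_lift g - c *: (free_lift g *m free_lift f) - free_lift h.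
Proof.
by rewrite !mulmxE -(free_liftM f g) -(free_liftM g f) -free_liftZ !free_liftB.
Qed.

End FreeLift.

Section FreeWords.
Variables (K : comNzRingType) (T : choiceType).

Lemma free_monomE (m : fmonom T) (c : K) :
  mkmalgU m c = c *: \prod_(x <- m) free_gen K x :> free_alg K T.
Proof.
suff E : (mkmalgU m 1 : free_alg K T) = \prod_(x <- m) free_gen K x.
  rewrite -E; apply/monalg.malgP => k; rewrite [LHS]monalg.mcoeffU [RHS]monalg.mcoeffZ.
  by rewrite monalg.mcoeffU mulr_natr.
case: m => s; elim: s => [|x s IH].
  rewrite big_nil; apply/monalg.malgP => k; rewrite monalg.mcoeffU monalg.mcoeff1.
  have -> : mone = FMonom [::] :> fmonom T by exact: fmoneE.
  by rewrite eq_sym.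
rewrite big_cons -IH /free_gen; transitivity
  (fgmul (mkmalgU (fmu x) 1 : monalg.malg _ _) (mkmalgU (FMonom s) (1 : K))); last by [].
by rewrite fgmulUU mulr1; congr mkmalgU; rewrite fmuE [RHS]fmmulE.
Qed.

Lemma free_algE (g : free_alg K T) :
  g = \sum_(m <- monalg.msupp g) monalg.mcoeff m g *: \prod_(x <- m) free_gen K x.
Proof.
by rewrite [LHS]monalg.monalgE; apply: eq_bigr => m _; rewrite free_monomE.
Qed.

End FreeWords.

(** * The enveloping algebra *)

Section UqBasics.
Variables (K : fieldType) (N : nat).
Local Notation U := (Uq K N).
Local Notation Q := (queer K N).
Local Notation F := (@Fgen K N).
Local Notation idx := 'I_(N + N).
Local Notation tensor := (free_alg K (subvs_of Q)).

Lemma Upi_mul (f g : tensor) : \pi_U (f * g) = \pi_U f * \pi_U g.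
Proof.
exact: (pi_quot_mul (@ideal_mull K tensor (@Urel K N))
  (@ideal_mulr K tensor (@Urel K N))).
Qed.

Lemma Upi_scale k (f : tensor) : \pi_U (k *: f) = k *: \pi_U f.
Proof. exact: (pi_quot_scale (@ideal_mull K tensor (@Urel K N))). Qed.

Lemma Upi_add (f g : tensor) : \pi_U (f + g) = \pi_U f + \pi_U g.
Proof. by rewrite !piE. Qed.

Lemma Upi0 : \pi_U (0 : tensor) = 0.
Proof. by apply: (addrI (\pi_U (0 : tensor))); rewrite -Upi_add !addr0. Qed.

Lemma Upi1 : \pi_U (1 : tensor) = 1.
Proof. by rewrite !piE. Qed.

Lemma Upi_sum (I : Type) (r : seq I) (P : pred I) (f : I -> tensor) :
  \pi_U (\sum_(i <- r | P i) f i) = \sum_(i <- r | P i) \pi_U (f i).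
Proof. exact: (big_morph _ Upi_add Upi0). Qed.

Lemma Upi_prod (I : Type) (r : seq I) (f : I -> tensor) :
  \pi_U (\prod_(i <- r) f i) = \prod_(i <- r) \pi_U (f i).
Proof. exact: (big_morph _ Upi_mul Upi1). Qed.

Lemma Upi_eq0 f : Urel f -> \pi_U f = 0.
Proof.
move=> rel_f; rewrite -Upi0; apply/eqP; rewrite -Quotient.idealrBE subr0.
by apply/in_idealP/ideal_rel.
Qed.

Lemma Upi_sub (f g : tensor) : \pi_U (f - g) = \pi_U f - \pi_U g.
Proof. by rewrite -scaleN1r Upi_add Upi_scale scaleN1r. Qed.

Lemma iota_q_linear : linear (@iota_q K N).
Proof.
move=> k x y; have := Upi_eq0 (Urel_linear k x y).
rewrite (Upi_sub (free_gen K _)) Upi_add Upi_scale => /eqP.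
by rewrite subr_eq0 => /eqP.
Qed.
HB.instance Definition _ := GRing.isLinear.Build K (subvs_of Q) U _ (@iota_q K N) iota_q_linear.

Lemma iota_qZ k x : iota_q (k *: x) = k *: iota_q x :> U.
Proof. exact: linearZ_LR. Qed.

Lemma iota_qD x y : iota_q (x + y) = iota_q x + iota_q y :> U.
Proof. exact: raddfD. Qed.

Lemma iota_qB x y : iota_q (x - y) = iota_q x - iota_q y :> U.
Proof. exact: raddfB. Qed.

Lemma Upi_bracket_eq0 (f g h : tensor) c :
  \pi_U (f * g - c *: (g * f) - h) = 0 ->
  \pi_U f * \pi_U g = c *: (\pi_U g * \pi_U f) + \pi_U h.
Proof.
rewrite (Upi_sub (f * g - _) h) (Upi_sub (f * g)) (Upi_scale c (g * f)).
rewrite -(Upi_mul f g) -(Upi_mul g f) => /eqP.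
by rewrite subr_eq0 => /eqP <-; rewrite addrC subrK.
Qed.

Lemma iota_q_bracket a b (x y z : subvs_of Q) :
  gl_parity a (vsval x) -> gl_parity b (vsval y) ->
  vsval z = gl_bracket a b (vsval x) (vsval y) ->
  iota_q x * iota_q y = (-1) ^+ (a && b) *: (iota_q y * iota_q x) + iota_q z.
Proof.
by move=> pa pb zE; apply/Upi_bracket_eq0/Upi_eq0/(Urel_bracket pa pb zE).
Qed.

Lemma iopp_ipos (k : 'I_N) : iopp (lshift N k) = rshift N k.
Proof. by rewrite /iopp -/(unsplit (inl k)) unsplitK. Qed.

Lemma iopp_ineg (k : 'I_N) : iopp (rshift N k) = lshift N k.
Proof. by rewrite /iopp -/(unsplit (inr k)) unsplitK. Qed.

Lemma iopp_cases (i : idx) :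
  (exists k, i = ipos k) \/ (exists k, i = iopp (ipos k)).
Proof.
by case: (split_ordP i) => k ->; [left | right]; exists k; rewrite // /ipos iopp_ipos.
Qed.

Lemma ioppK : involutive (@iopp N).
Proof.
by move=> i; case: (split_ordP i) => k ->; rewrite !(iopp_ipos, iopp_ineg).
Qed.

Lemma ipar_ipos (k : 'I_N) : ipar (ipos k) = false.
Proof. by rewrite /ipar /= leqNgt ltn_ord. Qed.

Lemma ipar_opp (i : idx) : ipar (iopp i) = ~~ ipar i.
Proof.
case: (split_ordP i) => k ->; rewrite (iopp_ipos, iopp_ineg) /ipar /=.
  by rewrite leq_addr [in RHS]leqNgt ltn_ord.
by rewrite leq_addr leqNgt ltn_ord.
Qed.

Lemma iopp_neq (i : idx) : (iopp i == i) = false.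
Proof. by apply/negP => /eqP/(congr1 (@ipar N)); rewrite ipar_opp; case: ipar. Qed.

Lemma ioppE (i j : idx) : (iopp i == j) = (i == iopp j).
Proof. by apply/eqP/eqP => [<-|->]; rewrite ioppK. Qed.

Lemma sum_idx (V : nmodType) (G : idx -> V) :
  \sum_i G i = \sum_(k < N) (G (ipos k) + G (iopp (ipos k))).
Proof.
rewrite big_split_ord /= big_split /=; congr (_ + _); apply: eq_bigr => k _.
by rewrite /ipos iopp_ipos.
Qed.

Lemma Fmx_opp i j : @Fmx K N (iopp i) (iopp j) = @Fmx K N i j.
Proof. by rewrite /Fmx !ioppK addrC. Qed.

Lemma Fgen_opp i j : F (iopp i) (iopp j) = F i j.
Proof. by rewrite /Fgen; congr iota_q; apply: val_inj => /=; rewrite Fmx_opp. Qed.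

(** Since F_(-i,-j) = F_ij, the generators with positive row index already span, and no factor 1/2
    appears. *)
Lemma iopp_invariant_sum (A : 'M[K]_(N + N)) :
  (forall i j, A (iopp i) (iopp j) = A i j) ->
  A = \sum_(k < N) \sum_j A (ipos k) j *: @Fmx K N (ipos k) j.
Proof.
move=> AE; rewrite {1}(matrix_sum_delta A) sum_idx; apply: eq_bigr => k _.
under [in RHS]eq_bigr do rewrite scalerDr.
rewrite [RHS]big_split /=; congr (_ + _).
rewrite (reindex_inj (inv_inj ioppK)) /=; apply: eq_bigr => j _.
by rewrite AE.
Qed.

Lemma queerP (A : 'M[K]_(N + N)) :
  reflect (forall i j, A (iopp i) (iopp j) = A i j) (A \in Q).
Proof.
apply: (iffP idP) => [AQ i j|/iopp_invariant_sum ->]; last first.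
  by apply: memv_suml => k _; apply: memv_suml => j _; apply/memvZ/mem_Fmx.
case/memv_sumP: AQ => B Bin ->; rewrite !summxE; apply: eq_bigr => k _.
have /memv_sumP[D Din ->] := Bin k isT; rewrite !summxE; apply: eq_bigr => l _.
have /vlineP[c ->] := Din l isT; rewrite !mxE; congr (_ * _).
by rewrite addrC !ioppE !ioppK.
Qed.

Lemma queer_sum (x : subvs_of Q) :
  x = \sum_(k < N) \sum_j vsval x (ipos k) j *: Subvs (mem_Fmx K (ipos k) j).
Proof.
apply: val_inj => /=; rewrite raddf_sum /= {1}(iopp_invariant_sum (elimT (queerP _) (subvsP x))).
by apply: eq_bigr => k _; rewrite raddf_sum.
Qed.

Lemma iota_q_sum (x : subvs_of Q) :
  iota_q x = \sum_(k < N) \sum_j vsval x (ipos k) j *: F (ipos k) j.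
Proof.
rewrite {1}(queer_sum x) raddf_sum; apply: eq_bigr => k _.
by rewrite raddf_sum; apply: eq_bigr => j _; exact: iota_qZ.
Qed.

(** Expansion along the even columns instead of the rows: right multiplication by the parity
    operator fixes these columns, which [qproj_mul_eps] exploits. *)
Lemma iota_q_sum_col (x : subvs_of Q) :
  iota_q x = \sum_(k < N) \sum_i vsval x i (ipos k) *: F i (ipos k).
Proof.
rewrite iota_q_sum (eq_bigr _ (fun k _ => sum_idx _)) exchange_big.
apply: eq_bigr => l _; rewrite sum_idx; apply: eq_bigr => k _ /=.
have /queerP xE := subvsP x.
have -> : F (ipos k) (iopp (ipos l)) = F (iopp (ipos k)) (ipos l).
  by rewrite -[LHS]Fgen_opp ioppK.
suff -> : vsval x (ipos k) (iopp (ipos l)) = vsval x (iopp (ipos k)) (ipos l) by [].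
by rewrite -[LHS]xE ioppK.
Qed.

Lemma iopp_eq2 (i j : idx) : (iopp i == iopp j) = (i == j).
Proof. by rewrite ioppE ioppK. Qed.

(** The spanning half of Poincare-Birkhoff-Witt. The sections on faithfulness and on highest weights
    take this principle as a hypothesis on an abstract algebra. *)
Lemma Uq_ind (P : U -> Prop) :
  P 1 -> (forall x y, P x -> P y -> P (x + y)) -> (forall k x, P x -> P (k *: x)) ->
  (forall i j x, P x -> P (F i j * x)) -> forall x, P x.
Proof.
move=> P1 PD PZ PF x.
have P0 : P 0 by rewrite -(scale0r 1); apply: PZ.
have PS I (r : seq I) (f : I -> U) : (forall i, P (f i)) -> P (\sum_(i <- r) f i).
  by move=> Pf; elim/big_ind: _.
rewrite -[x]reprK (free_algE (repr x)) Upi_sum; apply: (PS) => m.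
rewrite Upi_scale; apply: (PZ); rewrite Upi_prod.
elim: (fmonom_val m) => [|a s IH]; first by rewrite big_nil.
rewrite big_cons -/(iota_q a) iota_q_sum mulr_suml; apply: (PS) => k.
by rewrite mulr_suml; apply: (PS) => j; rewrite -scalerAl; apply/PZ/PF.
Qed.

End UqBasics.

Section UqBracket.
Variables (K : fieldType) (N : nat).
Local Notation U := (Uq K N).
Local Notation Q := (queer K N).
Local Notation F := (@Fgen K N).
Local Notation idx := 'I_(N + N).

(** q_N is closed under the matrix product itself, so the bracket of two generators is read off from
    two such products. *)
Lemma Fmx_mul (i j k l : idx) : Fmx K i j *m Fmx K k l =
  (j == k)%:R *: Fmx K i l + (iopp j == k)%:R *: Fmx K (iopp i) l.
Proof.
rewrite /Fmx mulmxDl !mulmxDr !mul_delta_mx_cond iopp_eq2 -[j == iopp k]ioppE ioppK.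
rewrite !scaler_nat !mulrnDl -!addrA; congr (_ + _).
by rewrite addrA addrC; congr (_ + _); rewrite addrC.
Qed.

Lemma Fmx_parity (i j : idx) : gl_parity (ipar i (+) ipar j) (Fmx K i j).
Proof.
move=> a b; rewrite !mxE.
case: (a =P i) => [-> | ai].
  by case: (b =P j) => [-> | bj] //=; rewrite [i == _]eq_sym iopp_neq addr0 eqxx.
rewrite /= add0r; case: (a =P iopp i) => [-> | _]; last by rewrite eqxx.
case: (b =P iopp j) => [-> | _]; last by rewrite eqxx.
by rewrite !ipar_opp addNb addbN negbK.
Qed.

Definition Fsign (i j k l : idx) : K :=
  (-1) ^+ ((ipar i (+) ipar j) && (ipar k (+) ipar l)).

Definition queer_bracket (A : algType K) (f : idx -> idx -> A) : Prop :=
  forall i j k l : idx, f i j * f k l = Fsign i j k l *: (f k l * f i j) +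
    ((j == k)%:R *: f i l + (iopp j == k)%:R *: f (iopp i) l
     - Fsign i j k l *: ((l == i)%:R *: f k j + (iopp l == i)%:R *: f (iopp k) j)).

Lemma Fgen_bracket : queer_bracket F.
Proof.
move=> i j k l.
pose f (a b : idx) := Subvs (mem_Fmx K a b).
pose z := (j == k)%:R *: f i l + (iopp j == k)%:R *: f (iopp i) l
   - Fsign i j k l *: ((l == i)%:R *: f k j + (iopp l == i)%:R *: f (iopp k) j).
have -> : (j == k)%:R *: F i l + (iopp j == k)%:R *: F (iopp i) l
   - Fsign i j k l *: ((l == i)%:R *: F k j + (iopp l == i)%:R *: F (iopp k) j)
   = iota_q z.
  by rewrite /z iota_qB iota_qD 3!iota_qZ iota_qD 2!iota_qZ.
apply: iota_q_bracket; [exact: Fmx_parity | exact: Fmx_parity |].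
by rewrite /= /gl_bracket !Fmx_mul.
Qed.

End UqBracket.

(** * Tensor powers of the extended natural module *)

Section TensorLinear.
Variables (R : comPzRingType) (m n p q : nat).
Implicit Types (A : 'M[R]_(m, n)) (B : 'M[R]_(p, q)).

Lemma tensmxDl A A' B : (A + A') *t B = A *t B + A' *t B.
Proof. by apply/matrixP => i j; rewrite !mxE mulrDl. Qed.

Lemma tensmxDr A B B' : A *t (B + B') = A *t B + A *t B'.
Proof. by apply/matrixP => i j; rewrite !mxE mulrDr. Qed.

Lemma tensmxZl c A B : (c *: A) *t B = c *: (A *t B).
Proof. by apply/matrixP => i j; rewrite !mxE mulrA. Qed.

Lemma tensmxZr c A B : A *t (c *: B) = c *: (A *t B).
Proof. by apply/matrixP => i j; rewrite !mxE mulrCA. Qed.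

End TensorLinear.

Lemma tensmx11 (R : comPzRingType) m n : (1%:M : 'M[R]_m) *t (1%:M : 'M[R]_n) = 1%:M.
Proof.
apply/matrixP => i j; case: (mxtens_indexP i) => a b; case: (mxtens_indexP j) => c e.
rewrite tensmxE !mxE (can_eq (@mxtens_indexK _ _)) xpair_eqE.
by case: (a == c); case: (b == e); rewrite /= ?mulr1 ?mulr0.
Qed.

Section TensorPowers.
Variables (K : fieldType) (N : nat).
Local Notation U := (Uq K N).
Local Notation Q := (queer K N).
Local Notation F := (@Fgen K N).
Local Notation idx := 'I_(N + N).
Local Notation gl := 'M[K]_(N + N).

(* The natural module extended by a trivial summand, so that the identity of
   the extended module is not in the image of q_N. *)
Definition hat (x : gl) : 'M[K]_(N + N + 1) := block_mx x 0 0 0.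

Definition parity_mx : gl := diag_mx (\row_i (-1) ^+ ipar i).

(** The Koszul sign as an operator: an element of parity b that passes the first tensor factor
    leaves [eps b] there. The trivial summand is even. *)
Definition eps (b : bool) : 'M[K]_(N + N + 1) :=
  if b then block_mx parity_mx 0 0 1%:M else 1%:M.

Definition part (b : bool) (x : gl) : gl :=
  \matrix_(i, j) (x i j *+ (ipar i (+) ipar j == b)).

Fixpoint tdim (n : nat) : nat := if n is n'.+1 then (N + N + 1) * tdim n' else 1.

(** The super tensor product written with ordinary Kronecker products. Splitting x into homogeneous
    parts makes the formula linear in x. *)
Fixpoint rho_gl (n : nat) : gl -> 'M[K]_(tdim n) :=
  if n is n'.+1 return gl -> 'M[K]_(tdim n) then
    fun x => hat x *t 1%:M + eps false *t rho_gl n' (part false x)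
             + eps true *t rho_gl n' (part true x)
  else fun=> 0.

Lemma hat_linear k x y : hat (k *: x + y) = k *: hat x + hat y.
Proof. by rewrite /hat scale_block_mx add_block_mx !scaler0 !addr0. Qed.

Lemma hatM x y : hat x *m hat y = hat (x *m y).
Proof. by rewrite /hat mulmx_block !mul0mx !mulmx0 !addr0. Qed.

Lemma part_linear b k x y : part b (k *: x + y) = k *: part b x + part b y.
Proof. by apply/matrixP => i j; rewrite !mxE mulrnDl mulrnAr. Qed.

Lemma part_hom b c x : gl_parity b x -> part c x = if c == b then x else 0.
Proof.
move=> px; apply/matrixP => i j; rewrite !mxE.
have [x0 | xij] := eqVneq (x i j) 0.
  by rewrite x0 mul0rn; case: ifP; rewrite ?mxE ?x0.
by rewrite (px i j xij) eq_sym; case: (c == b); rewrite ?mxE ?mulr1n ?mulr0n.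
Qed.

Lemma rho_gl_linear n : linear (rho_gl n).
Proof.
elim: n => [|n IH] k x y /=; first by rewrite scaler0 addr0.
rewrite hat_linear !part_linear !IH !tensmxDl !tensmxDr !tensmxZl !tensmxZr.
by rewrite !scalerDr [RHS]addrACA; congr (_ + _); rewrite addrACA.
Qed.
HB.instance Definition _ n := GRing.isLinear.Build K gl 'M[K]_(tdim n) _ (rho_gl n) (rho_gl_linear n).

Lemma rho_gl_hom n b x : gl_parity b x ->
  rho_gl n.+1 x = hat x *t 1%:M + eps b *t rho_gl n x.
Proof.
move=> px /=; rewrite !(part_hom _ px).
by case: b {px}; rewrite /= linear0 tensmx0 addr0.
Qed.

Lemma epsM a b : eps a *m eps b = eps (a (+) b).
Proof.
have PP : parity_mx *m parity_mx = 1%:M.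
  rewrite /parity_mx mulmx_diag -diag_const_mx; congr diag_mx.
  by apply/rowP => i; rewrite !mxE -expr2 sqrr_sign.
case: a; case: b; rewrite /= ?mulmx1 ?mul1mx // mulmx_block !mulmx0 !mul0mx.
by rewrite !addr0 !add0r PP mulmx1 -scalar_mx_block.
Qed.

Lemma eps_hat a b x : gl_parity b x ->
  eps a *m hat x = (-1) ^+ (a && b) *: (hat x *m eps a).
Proof.
move=> px; case: a => /=; last by rewrite mul1mx mulmx1 scale1r.
rewrite /hat !mulmx_block !mulmx0 !mul0mx !addr0 scale_block_mx !scaler0.
congr block_mx; apply/matrixP => i j; rewrite !mxE.
rewrite (bigD1 i) //= big1 ?addr0; last first.
  by move=> k ki; rewrite !mxE eq_sym (negbTE ki) mulr0n mul0r.
rewrite (bigD1 j) //= big1 ?addr0; last first.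
  by move=> k kj; rewrite !mxE (negbTE kj) mulr0n mulr0.
rewrite !mxE !eqxx !mulr1n.
have [-> | xij] := eqVneq (x i j) 0; first by rewrite !(mulr0, mul0r).
rewrite -(px i j xij) mulrCA mulrC; congr (_ * _).
by case: ipar; case: ipar; rewrite /= ?expr0 ?expr1 ?mulrNN ?mulr1 ?mul1r.
Qed.

Lemma gl_bracket_parity a b (x y : gl) : gl_parity a x -> gl_parity b y ->
  gl_parity (a (+) b) (gl_bracket a b x y).
Proof.
have mulP (c e : bool) (u v : gl) : gl_parity c u -> gl_parity e v -> forall i j,
    ipar i (+) ipar j != c (+) e -> (u *m v) i j = 0.
  move=> pu pv i j; rewrite mxE => ne; apply: big1 => k _; apply/eqP; rewrite mulf_eq0.
  apply: contraNT ne; rewrite negb_or => /andP[/pu <- /pv <-].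
  by rewrite addbA -[_ (+) _ (+) ipar k]addbA addbb addbF.
move=> px py i j; apply: contraNeq => ne; rewrite !mxE.
have := mulP _ _ _ _ px py i j ne; rewrite mxE => ->.
have ne' : ipar i (+) ipar j != b (+) a by rewrite [b (+) a]addbC.
have := mulP _ _ _ _ py px i j ne'; rewrite mxE => ->.
by rewrite mulr0 subr0.
Qed.

Lemma hat_bracket a b (x y : gl) :
  hat (gl_bracket a b x y) = hat x *m hat y - (-1) ^+ (a && b) *: (hat y *m hat x).
Proof.
by rewrite /gl_bracket addrC -scaleNr hat_linear !hatM addrC scaleNr.
Qed.

(** The mixed terms, with x on one factor and y on the other, cancel: by [eps_hat], moving [eps]
    across [hat] yields exactly the sign (-1)^(ab) of the supercommutator. *)
Lemma rho_gl_bracket n a b (x y : gl) : gl_parity a x -> gl_parity b y ->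
  rho_gl n (gl_bracket a b x y) =
  rho_gl n x *m rho_gl n y - (-1) ^+ (a && b) *: (rho_gl n y *m rho_gl n x).
Proof.
move=> px py; elim: n => [|n IH]; first by rewrite /= !mul0mx scaler0 subr0.
rewrite (rho_gl_hom _ (gl_bracket_parity px py)) (rho_gl_hom _ px) (rho_gl_hom _ py).
rewrite IH hat_bracket !mulmxDl !mulmxDr !tensmx_mul !mul1mx !mulmx1 !epsM.
rewrite (eps_hat _ py) (eps_hat _ px) [b && a]andbC [b (+) a]addbC.
rewrite !tensmxDl !tensmxDr -!scaleNr !tensmxZl !tensmxZr !scalerDr !scalerA.
rewrite mulNr -expr2 sqrr_sign scaleN1r !scaleNr.
rewrite [RHS]addrACA [X in _ = X + _]addrACA [X in _ = _ + X]addrACA.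
by rewrite -[RHS]addrA [X in _ = _ + X]addrA subrKA subrr add0r.
Qed.

Definition rho_free n : free_alg K (subvs_of Q) -> 'M[K]_(tdim n) :=
  free_lift (fun x : subvs_of Q => rho_gl n (vsval x)).

Lemma rho_free_ideal n f : ideal (@Urel K N) f -> rho_free n f = 0.
Proof.
rewrite /rho_free; elim=> {f} [f [k x y|a b x y z pa pb zE]||f g _ Ef _ Eg|f g _ Eg|f g _ Ef].
- by rewrite free_liftB free_lift_linear !free_lift_gen /= linearP subrr.
- by rewrite free_lift_bracket !free_lift_gen zE rho_gl_bracket // subrr.
- exact: free_lift0.
- by rewrite free_liftD Ef Eg addr0.
- by rewrite free_liftM Eg mulr0.
- by rewrite free_liftM Ef mul0r.
Qed.

Definition rho n (u : U) : 'M[K]_(tdim n) := rho_free n (repr u).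

Lemma rho_pi n f : rho n (\pi_U f) = rho_free n f.
Proof.
have : f - repr (\pi_U f) \in in_ideal (@Urel K N) by apply: quot_repr.
move=> /in_idealP/(rho_free_ideal n) /eqP.
rewrite /rho_free -scaleN1r free_liftD free_liftZ scaleN1r subr_eq0 => /eqP E.
by rewrite /rho /rho_free -E.
Qed.

Lemma rho_linear n : linear (rho n).
Proof.
move=> k x y; rewrite -[x]reprK -[y]reprK -Upi_scale -Upi_add !rho_pi.
exact: free_lift_linear.
Qed.
HB.instance Definition _ n := GRing.isLinear.Build K U 'M[K]_(tdim n) _ (rho n) (rho_linear n).

Lemma rhoM n x y : rho n (x * y) = rho n x *m rho n y.
Proof. rewrite -[x]reprK -[y]reprK -Upi_mul !rho_pi; exact: free_liftM. Qed.

Lemma rho1 n : rho n 1 = 1%:M.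
Proof. rewrite -Upi1 rho_pi; exact: free_lift1. Qed.

Lemma rho_iota n x : rho n (iota_q x) = rho_gl n (vsval x).
Proof. by rewrite rho_pi /rho_free free_lift_gen. Qed.

Lemma rho_F n i j : rho n (F i j) = rho_gl n (Fmx K i j).
Proof. exact: rho_iota. Qed.

Lemma rho_FS n i j : rho n.+1 (F i j) =
  hat (Fmx K i j) *t 1%:M + eps (ipar i (+) ipar j) *t rho n (F i j).
Proof. by rewrite !rho_F (rho_gl_hom _ (@Fmx_parity _ _ i j)). Qed.

Lemma rhoD n x y : rho n (x + y) = rho n x + rho n y.
Proof. exact: raddfD. Qed.

Lemma rhoZ n k x : rho n (k *: x) = k *: rho n x.
Proof. exact: linearZ_LR. Qed.

Lemma rho_sum n (I : Type) (r : seq I) (P : pred I) (f : I -> U) :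
  rho n (\sum_(i <- r | P i) f i) = \sum_(i <- r | P i) rho n (f i).
Proof. exact: raddf_sum. Qed.

End TensorPowers.

(** * Joint faithfulness of the tensor powers *)

Section Faithful.
Variables (K : fieldType) (N : nat).
Local Notation idx := 'I_(N + N).
Variables (U : algType K) (F : idx -> idx -> U).
Local Notation gl := 'M[K]_(N + N).
Local Notation hmx := 'M[K]_(N + N + 1).
Local Notation letter := (idx * idx)%type.

Definition lpar (a : letter) : bool := ipar a.1 (+) ipar a.2.
Definition wpar (s : seq letter) : bool := foldr (fun a b => lpar a (+) b) false s.
Definition lmx (a : letter) : gl := Fmx K a.1 a.2.
Definition lgen (a : letter) : U := F a.1 a.2.
Definition word (s : seq letter) : U := foldr (fun a x => lgen a * x) 1 s.

Hypothesis Fbracket : queer_bracket F.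

Hypothesis Fcol : forall a b : idx,
  F a b = \sum_(k < N) \sum_i Fmx K a b i (ipos k) *: F i (ipos k).

Hypothesis Find : forall P : U -> Prop,
  P 1 -> (forall x y, P x -> P y -> P (x + y)) -> (forall k x, P x -> P (k *: x)) ->
  (forall i j x, P x -> P (F i j * x)) -> forall x, P x.

(** The span of the words of length less than d. The strict bound makes [filt 0] the zero space,
    where the descent of [rho_faithful] ends. *)
Inductive filt (d : nat) : U -> Prop :=
| filt0 : filt d 0
| filt_cons k s x : (size s < d)%N -> filt d x -> filt d (k *: word s + x).

Lemma filtD d x y : filt d x -> filt d y -> filt d (x + y).
Proof.
by elim=> [|k s z ss _ IH] fy; rewrite ?add0r // -addrA; apply: filt_cons => //; apply: IH.
Qed.

Lemma filtZ d k x : filt d x -> filt d (k *: x).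
Proof.
elim=> [|c s z ss _ IH]; first by rewrite scaler0; exact: filt0.
by rewrite scalerDr scalerA; apply: filt_cons.
Qed.

Lemma filtN d x : filt d x -> filt d (- x).
Proof. by rewrite -scaleN1r; apply: filtZ. Qed.

Lemma filtB d x y : filt d x -> filt d y -> filt d (x - y).
Proof. by move=> fx /filtN; apply: filtD. Qed.

Lemma filt_word d s : (size s < d)%N -> filt d (word s).
Proof. by move=> ss; rewrite -[word s]addr0 -[word s]scale1r; apply: filt_cons (filt0 d). Qed.

Lemma filt_mono d e x : (d <= e)%N -> filt d x -> filt e x.
Proof.
move=> de; elim=> [|k s z ss _ IH]; first exact: filt0.
by apply: filt_cons => //; apply: leq_trans de.
Qed.

Lemma filt_lgen d a x : filt d x -> filt d.+1 (lgen a * x).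
Proof.
elim=> [|c s z ss _ IH]; first by rewrite mulr0; exact: filt0.
by rewrite mulrDr -scalerAr; apply: (@filt_cons _ _ (a :: s)).
Qed.

Lemma filt_sum d (T : eqType) (r : seq T) (f : T -> U) :
  (forall t, t \in r -> filt d (f t)) -> filt d (\sum_(t <- r) f t).
Proof.
move=> ff; rewrite big_seq; elim/big_ind: _ => //; [exact: filt0 | exact: filtD].
Qed.

Lemma filt_exhaust x : exists d, filt d x.
Proof.
elim/Find: x => [|x y [d fx] [e fy]|k x [d fx]|i j x [d fx]].
- by exists 1; apply: (@filt_word _ [::]).
- exists (maxn d e); apply: filtD; [apply: filt_mono fx | apply: filt_mono fy].
    exact: leq_maxl.
  exact: leq_maxr.
- by exists d; apply: filtZ.
- by exists d.+1; apply: (@filt_lgen _ (i, j)).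
Qed.

(* The ways of extracting a letter from a word, each with the sign of moving
   that letter to the front. *)
Fixpoint picks (s : seq letter) : seq (K * letter * seq letter) :=
  if s is a :: s' then
    (1, a, s') :: [seq (t.1.1 * (-1) ^+ (lpar a && lpar t.1.2), t.1.2, a :: t.2) | t <- picks s']
  else [::].

Lemma size_picks s t : t \in picks s -> size s = (size t.2).+1.
Proof.
elim: s t => [|a s IH] t //=; rewrite inE => /orP[/eqP -> //|/mapP[u /IH -> ->]].
by [].
Qed.

(** The bracket of two letters is a combination of letters, so swapping the first two letters of a
    word of length [size s + 2] costs words of length [size s + 1]. *)
Lemma lgen_comm a b s :
  filt (size s).+2 ((-1) ^+ (lpar a && lpar b) *: (lgen b * (lgen a * word s))
                    - lgen a * (lgen b * word s)).
Proof.
have [G ab fG] : exists2 G, lgen a * lgen b = (-1) ^+ (lpar a && lpar b) *: (lgen b * lgen a) + G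
    & filt (size s).+2 (G * word s).
  eexists; first exact: Fbracket.
  have fl i j : filt (size s).+2 (F i j * word s) by apply: (@filt_word _ ((i, j) :: s)).
  rewrite mulrBl -scalerAl !mulrDl -!scalerAl.
  by apply: filtB; [|apply: filtZ]; apply: filtD; apply: filtZ; apply: fl.
rewrite [lgen a * (_ * _)]mulrA ab mulrDl -scalerAl -[lgen b * _ * _]mulrA opprD addNKr.
exact: filtN.
Qed.

(** Modulo shorter words, moving a letter to the front restores the word, so each of the [size s]
    picks contributes one copy. Iterated, this is the origin of n! in [Theta_top]. *)
Lemma picks_sum s :
  filt (size s) (\sum_(t <- picks s) t.1.1 *: (lgen t.1.2 * word t.2) - (size s)%:R *: word s).
Proof.
elim: s => [|a s IH] /=; first by rewrite big_nil scale0r subr0; exact: filt0.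
rewrite big_cons big_map /= scale1r -natr1 scalerDl scale1r.
rewrite [X in _ - X]addrC opprD addrACA subrr add0r.
pose S := \sum_(t <- picks s) t.1.1 *: (lgen t.1.2 * word t.2).
rewrite -[X in filt _ (X - _)](subrK (lgen a * S)) -addrA; apply: filtD; last first.
  by rewrite scalerAr -mulrBr; apply: filt_lgen.
rewrite /S mulr_sumr -sumrB; apply: filt_sum => t tin.
rewrite -scalerA -scalerAr -scalerBr; apply: filtZ.
by rewrite (size_picks tin); apply: lgen_comm.
Qed.

Definition hv (i : idx) : 'I_(N + N + 1) := lshift 1 i.
Definition hc : 'I_(N + N + 1) := rshift (N + N) ord0.
(** The identity matrix, seen as an element of q_N. *)
Definition qid : U := \sum_(k < N) F (ipos k) (ipos k).

(* The correction by the entry of the trivial summand makes qproj vanish at the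
   identity and at the parity operator. *)
Definition qproj (A : hmx) : U :=
  \sum_(k < N) \sum_i A (hv i) (hv (ipos k)) *: F i (ipos k) - A hc hc *: qid.

Definition tblock n (a b : 'I_(N + N + 1)) (M : 'M[K]_((N + N + 1) * n)) : 'M[K]_n :=
  \matrix_(i, j) M (mxtens_index (a, i)) (mxtens_index (b, j)).

(** The n-th tensor power of [qproj] followed by multiplication in U (see [Theta_tens]), written
    with blocks so as to be defined on every matrix. *)
Fixpoint Theta (n : nat) : 'M[K]_(tdim N n) -> U :=
  if n is n'.+1 return 'M[K]_(tdim N n) -> U then
    fun M => \sum_(k < N) \sum_i F i (ipos k) * Theta (tblock (hv i) (hv (ipos k)) M)
             - qid * Theta (tblock hc hc M)
  else fun M => (M ord0 ord0)%:A.

Lemma Theta_linear n : linear (@Theta n).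
Proof.
elim: n => [|n IH] k A B; first by rewrite /= !mxE scalerDl scalerA.
have TB a b : tblock a b (k *: A + B) = k *: tblock a b A + tblock a b B.
  by apply/matrixP => i j; rewrite !mxE.
rewrite /= TB IH mulrDr -scalerAr scalerBr [RHS]addrACA -opprD; congr (_ - _).
rewrite scaler_sumr -big_split; apply: eq_bigr => l _.
rewrite scaler_sumr -big_split; apply: eq_bigr => i _.
by rewrite TB IH mulrDr scalerAr.
Qed.
HB.instance Definition _ n := GRing.isLinear.Build K 'M[K]_(tdim N n) U _ (@Theta n) (@Theta_linear n).

Lemma tblock_tens n (A : hmx) (B : 'M[K]_n) a b : tblock a b (A *t B) = A a b *: B.
Proof. by apply/matrixP => i j; rewrite !mxE !mxtens_indexK. Qed.

Lemma ThetaZ n k (M : 'M[K]_(tdim N n)) : Theta (k *: M) = k *: Theta M.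
Proof. exact: linearZ_LR. Qed.

Lemma ThetaD n (M M' : 'M[K]_(tdim N n)) : Theta (M + M') = Theta M + Theta M'.
Proof. exact: raddfD. Qed.

Lemma Theta0 n : Theta (0 : 'M[K]_(tdim N n)) = 0.
Proof. exact: raddf0. Qed.

Lemma Theta_tens n (A : hmx) (B : 'M[K]_(tdim N n)) :
  Theta (A *t B : 'M[K]_(tdim N n.+1)) = qproj A * Theta B.
Proof.
rewrite /= tblock_tens ThetaZ -scalerAr /qproj mulrBl -[_ *: qid * _]scalerAl.
congr (_ - _); rewrite [RHS]mulr_suml; apply: eq_bigr => k _.
rewrite [RHS]mulr_suml; apply: eq_bigr => i _.
by rewrite tblock_tens ThetaZ -scalerAl -scalerAr.
Qed.

Lemma qproj_eps b : qproj (eps K N b) = 0.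
Proof.
rewrite /qproj.
have -> : eps K N b hc hc = 1.
  by case: b; rewrite /= ?block_mxEdr !mxE eqxx.
rewrite scale1r; apply/eqP; rewrite subr_eq0; apply/eqP; apply: eq_bigr => k _.
rewrite (bigD1 (ipos k)) //= big1 ?addr0.
  case: b; rewrite /= ?block_mxEul ?mxE ?eqxx ?ipar_ipos ?mulr1n ?expr0 ?scale1r //.
move=> i ik; case: b; rewrite /= ?block_mxEul ?mxE ?eq_lshift ?(negbTE ik) ?mulr0n ?scale0r //.
Qed.

Lemma qproj_mul_eps A b : qproj (A *m eps K N b) = qproj A.
Proof.
case: b => /=; last by rewrite mulmx1.
rewrite -[A]submxK mulmx_block !mulmx0 !mulmx1 !addr0 !add0r /qproj.
rewrite !block_mxEdr; congr (_ - _); apply: eq_bigr => k _; apply: eq_bigr => i _.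
by rewrite !block_mxEul /parity_mx mul_mx_diag !mxE ipar_ipos expr0 mulr1.
Qed.

Lemma qproj_hat a : qproj (hat (lmx a)) = lgen a.
Proof.
rewrite /qproj /hat block_mxEdr mxE scale0r subr0.
rewrite [RHS]Fcol; apply: eq_bigr => k _; apply: eq_bigr => i _.
by rewrite block_mxEul.
Qed.

Variable rho : forall n, {linear U -> 'M[K]_(tdim N n)}.
Hypothesis rho1 : forall n, rho n 1 = 1%:M.
Hypothesis rhoM : forall n x y, rho n (x * y) = rho n x *m rho n y.
Hypothesis rhoFS : forall n i j, rho n.+1 (F i j) =
  hat (Fmx K i j) *t 1%:M + eps K N (ipar i (+) ipar j) *t rho n (F i j).

Inductive low n (d : nat) : 'M[K]_(tdim N n.+1) -> Prop :=
| low0 : low d 0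
| low_cons A s M : (size s < d)%N -> low d M -> low d (A *t rho n (word s) + M).

Lemma lowD n d (M M' : 'M[K]_(tdim N n.+1)) : low d M -> low d M' -> low d (M + M').
Proof.
by elim=> [|A s L ss _ IH] lM; rewrite ?add0r // -addrA; apply: low_cons => //; apply: IH.
Qed.

Lemma low_tens n d A s : (size s < d)%N -> @low n d (A *t rho n (word s)).
Proof. by move=> ss; rewrite -[_ *t _]addr0; apply: low_cons => //; apply: low0. Qed.

Lemma low_mono n d e (M : 'M[K]_(tdim N n.+1)) : (d <= e)%N -> low d M -> low e M.
Proof.
move=> de; elim=> [|A s L ss _ IH]; first exact: low0.
by apply: low_cons => //; apply: leq_trans de.
Qed.

Lemma low_sum n d (T : eqType) (r : seq T) (f : T -> 'M[K]_(tdim N n.+1)) :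
  (forall t, t \in r -> low d (f t)) -> low d (\sum_(t <- r) f t).
Proof.
move=> ff; rewrite big_seq; elim/big_ind: _ => //; [exact: low0 | exact: lowD].
Qed.

Lemma low_mull n d (A : hmx) (M : 'M[K]_(tdim N n.+1)) : low d M -> low d ((A *t 1%:M) *m M).
Proof.
elim=> [|B s L ss _ IH]; first by rewrite mulmx0; exact: low0.
by rewrite mulmxDr tensmx_mul mul1mx; apply: low_cons.
Qed.

Lemma low_mulr n d A a (M : 'M[K]_(tdim N n.+1)) :
  low d M -> low d.+1 ((A *t rho n (lgen a)) *m M).
Proof.
elim=> [|B s L ss _ IH]; first by rewrite mulmx0; exact: low0.
by rewrite mulmxDr tensmx_mul -rhoM; apply: (@low_cons _ _ _ (a :: s)).
Qed.

Definition pick_mx n (t : K * letter * seq letter) : 'M[K]_(tdim N n.+1) :=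
  t.1.1 *: ((hat (lmx t.1.2) *m eps K N (wpar t.2)) *t rho n (word t.2)).

(** The coproduct of a word, sorted by the number of letters that act on the first factor: none,
    exactly one (the picks), or at least two. The last kind makes up R, whose remaining words have
    lost two letters. *)
Lemma rho_word n s : exists2 R, @low n (size s).-1 R &
  rho n.+1 (word s) = eps K N (wpar s) *t rho n (word s)
                      + \sum_(t <- picks s) pick_mx n t + R.
Proof.
elim: s => [|a s [R lowR IH]] /=.
  by exists 0; [exact: low0 | rewrite big_nil !addr0 !rho1 tensmx11].
rewrite rhoM [in X in _ X]rhoFS IH.
set H := hat _ *t _; set E := eps _ _ _ *t _.
exists (H *m \sum_(t <- picks s) pick_mx n t + H *m R + E *m R).
  apply: lowD; [apply: lowD|].
  - rewrite mulmx_sumr; apply: low_sum => t tin; apply: low_mull.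
    rewrite /pick_mx -tensmxZl; apply: low_tens; rewrite (size_picks tin); exact: leqnn.
  - by apply/low_mull/low_mono/lowR; apply: leq_pred.
  (* For s empty the truncated predecessor gives the bound 0 both before and after adding a letter;
     then R = 0. *)
  - case: (size s) lowR => [|m] lowR; last exact: low_mulr.
    have -> : R = 0.
      by move: lowR => /=; elim=> // A s' M; rewrite ltn0.
    by rewrite mulmx0; apply: low0.
have HX : H *m (eps K N (wpar s) *t rho n (word s)) = pick_mx n (1, a, s).
  by rewrite /H tensmx_mul mul1mx /pick_mx scale1r.
have EX : E *m (eps K N (wpar s) *t rho n (word s))
          = eps K N (lpar a (+) wpar s) *t rho n (lgen a * word s).
  by rewrite /E tensmx_mul epsM rhoM.
have ES : E *m \sum_(t <- picks s) pick_mx n t = \sum_(t <- picks s)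
    pick_mx n (t.1.1 * (-1) ^+ (lpar a && lpar t.1.2), t.1.2, a :: t.2).
  rewrite mulmx_sumr; apply: eq_bigr => t _.
  rewrite /pick_mx /= -scalemxAr /E tensmx_mul mulmxA (eps_hat _ (@Fmx_parity _ _ _ _)).
  by rewrite -scalemxAl -mulmxA epsM tensmxZl scalerA rhoM.
rewrite !mulmxDl !mulmxDr big_cons big_map /= HX EX ES.
by rewrite [LHS](AC (3*3) (4*(1*5)*(2*3*6))).
Qed.

Lemma Theta_low n d (M : 'M[K]_(tdim N n.+1)) : (d <= n)%N ->
  (forall s, (size s < n)%N -> Theta (rho n (word s)) = 0) -> low d M -> Theta M = 0.
Proof.
move=> dn Th; elim=> [|A s L ss _ IH]; first exact: Theta0.
by rewrite ThetaD Theta_tens IH addr0 Th ?mulr0 //; apply: leq_trans dn.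
Qed.

Lemma Theta_pick n t : Theta (pick_mx n t) =
  t.1.1 *: (lgen t.1.2 * Theta (rho n (word t.2))).
Proof. by rewrite ThetaZ Theta_tens qproj_mul_eps qproj_hat. Qed.

(** [qproj] kills the term with no letter on the first factor, and the terms with at least two leave
    fewer than n letters for the other n factors. Only the picks survive. *)
Lemma Theta_word n s : (forall s, (size s < n)%N -> Theta (rho n (word s)) = 0) ->
  (size s <= n.+1)%N -> Theta (rho n.+1 (word s)) =
  \sum_(t <- picks s) t.1.1 *: (lgen t.1.2 * Theta (rho n (word t.2))).
Proof.
move=> Th sn; have [R lowR ->] := rho_word n s.
rewrite !ThetaD Theta_tens qproj_eps mul0r add0r (Theta_low _ Th lowR) ?addr0.
  rewrite (big_morph _ (@ThetaD _) (@Theta0 _)).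
  by apply: eq_bigr => t _; apply: Theta_pick.
by rewrite -ltnS; case: (size s) sn.
Qed.

(** With fewer than n letters, some factor carries only the identity or the parity operator, which
    [qproj] kills. *)
Lemma Theta_short n s : (size s < n)%N -> Theta (rho n (word s)) = 0.
Proof.
elim: n s => // n IH s sn; rewrite (Theta_word IH) ?(ltnW sn) // big_seq big1 // => t tin.
by rewrite IH ?mulr0 ?scaler0 // -ltnS -(size_picks tin).
Qed.

Lemma Theta_top n s : size s = n -> filt n (Theta (rho n (word s)) - n`!%:R *: word s).
Proof.
elim: n s => [|n IH] s sn.
  by case: s sn => //= _; rewrite rho1 !mxE scale1r subrr; exact: filt0.
rewrite (Theta_word (@Theta_short n)) ?sn //.
rewrite factS natrM mulrC -scalerA -sn.
have := filtZ n`!%:R (picks_sum s); rewrite scalerBr => fp.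
pose S := \sum_(t <- picks s) t.1.1 *: (lgen t.1.2 * word t.2).
rewrite -[X in filt _ (X - _)](subrK (n`!%:R *: S)).
rewrite -addrA; apply: filtD => //; rewrite scaler_sumr -sumrB; apply: filt_sum => t tin.
rewrite scalerA mulrC -scalerA -scalerBr; apply: filtZ.
rewrite scalerAr -mulrBr sn; apply/filt_lgen/IH; apply/succn_inj.
by rewrite -(size_picks tin).
Qed.

Hypothesis charK : forall n, n.+1%:R != 0 :> K.

(** [Theta] recovers d! x up to shorter words from [rho d x], and d! is invertible: the vanishing of
    [rho d x] lowers the degree of x by one. *)
Lemma filt_reduce d x : filt d.+1 x -> rho d x = 0 -> filt d x.
Proof.
move=> fx x0.
have : filt d (Theta (rho d x) - d`!%:R *: x).
  elim: fx {x0} => [|k s z ss _ IH]; first by rewrite linear0 Theta0 scaler0 subrr; exact: filt0.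
  rewrite linearP ThetaD ThetaZ scalerDr opprD addrACA; apply: filtD => //.
  rewrite scalerA mulrC -scalerA -scalerBr; apply: filtZ.
  move: ss; rewrite ltnS leq_eqVlt => /orP[/eqP|] ss; first exact: Theta_top.
  by rewrite Theta_short // sub0r; apply/filtN/filtZ/filt_word.
have fd : d`!%:R != 0 :> K by rewrite -(prednK (fact_gt0 d)).
rewrite x0 Theta0 sub0r => /filtN/(filtZ d`!%:R^-1).
by rewrite opprK scalerA mulVf // scale1r.
Qed.

Theorem rho_faithful x : (forall n, rho n x = 0) -> x = 0.
Proof.
move=> x0; have [d] := filt_exhaust x.
elim: d => [|d IH] fx; last exact/IH/filt_reduce.
by elim: fx => // k s z; rewrite ltn0.
Qed.

End Faithful.

(** * Highest weight vectors *)

Section Adjoint.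
Variable C : numClosedFieldType.

Definition adjm m n (A : 'M[C]_(m, n)) : 'M[C]_(n, m) := (map_mx Num.conj A)^T.

Lemma adjmE m n (A : 'M[C]_(m, n)) i j : adjm A i j = (A j i)^*.
Proof. by rewrite !mxE. Qed.

Lemma adjmM m n p (A : 'M[C]_(m, n)) (B : 'M[C]_(n, p)) : adjm (A *m B) = adjm B *m adjm A.
Proof. by rewrite /adjm map_mxM trmx_mul. Qed.

Lemma adjmD m n (A B : 'M[C]_(m, n)) : adjm (A + B) = adjm A + adjm B.
Proof. by apply/matrixP => i j; rewrite !(adjmE, mxE) rmorphD. Qed.

Lemma adjm0 m n : adjm (0 : 'M[C]_(m, n)) = 0.
Proof. by apply/matrixP => i j; rewrite !(adjmE, mxE) rmorph0. Qed.

Lemma adjmZ m n k (A : 'M[C]_(m, n)) : adjm (k *: A) = k^* *: adjm A.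
Proof. by apply/matrixP => i j; rewrite !(adjmE, mxE) rmorphM. Qed.

Lemma adjm1 n : adjm (1%:M : 'M[C]_n) = 1%:M.
Proof. by rewrite /adjm map_mx1 trmx1. Qed.

Lemma adjmK m n (A : 'M[C]_(m, n)) : adjm (adjm A) = A.
Proof. by apply/matrixP => i j; rewrite !adjmE conjCK. Qed.

Lemma adjm_tens m n p q (A : 'M[C]_(m, n)) (B : 'M[C]_(p, q)) :
  adjm (A *t B) = adjm A *t adjm B.
Proof. by apply/matrixP => i j; rewrite !mxE rmorphM. Qed.

Lemma adjm_mul_eq0 m n (A : 'M[C]_(m, n)) : adjm A *m A = 0 -> A = 0.
Proof.
move=> A0; apply/matrixP => i j; rewrite mxE.
have /eqP := congr1 (fun M : 'M_n => M j j) A0; rewrite !mxE psumr_eq0 => [|k _]; last first.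
  by rewrite adjmE mulrC mul_conjC_ge0.
move/allP/(_ i); rewrite mem_index_enum => /(_ isT) /=.
by rewrite adjmE mulrC mul_conjC_eq0 => /eqP.
Qed.

End Adjoint.

Section HighestWeight.
Variables (C : numClosedFieldType) (N : nat).
Local Notation idx := 'I_(N + N).
Variables (U : algType C) (F : idx -> idx -> U).

Hypothesis Fopp : forall i j, F (iopp i) (iopp j) = F i j.
Hypothesis Fbracket : queer_bracket F.

Hypothesis Find : forall P : U -> Prop,
  P 1 -> (forall x y, P x -> P y -> P (x + y)) -> (forall k x, P x -> P (k *: x)) ->
  (forall i j x, P x -> P (F i j * x)) -> forall x, P x.

Variable rho : forall n, {linear U -> 'M[C]_(tdim N n)}.
Hypothesis rho1 : forall n, rho n 1 = 1%:M.
Hypothesis rhoM : forall n x y, rho n (x * y) = rho n x *m rho n y.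
Hypothesis rhoF0 : forall i j, rho 0 (F i j) = 0.
Hypothesis rhoFS : forall n i j, rho n.+1 (F i j) =
  hat (Fmx C i j) *t 1%:M + eps C N (ipar i (+) ipar j) *t rho n (F i j).

Lemma adjm_hat_Fmx (i j : idx) : adjm (hat (Fmx C i j)) = hat (Fmx C j i).
Proof.
rewrite /adjm /hat map_block_mx !map_mx0 tr_block_mx !trmx0; congr block_mx.
by apply/matrixP => a b; rewrite !mxE rmorphD !rmorph_nat !(andbC (b == _)).
Qed.

Lemma adjm_eps b : adjm (eps C N b) = eps C N b.
Proof.
case: b => /=; last exact: adjm1.
rewrite /adjm map_block_mx !map_mx0 tr_block_mx !trmx0 map_mx1 trmx1; congr block_mx.
rewrite /parity_mx map_diag_mx tr_diag_mx; congr diag_mx; apply/rowP => i.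
by rewrite !mxE rmorph_sign.
Qed.

Lemma adjm_rhoF n i j : adjm (rho n (F i j)) = rho n (F j i).
Proof.
elim: n => [|n IH]; first by rewrite !rhoF0 adjm0.
by rewrite !rhoFS adjmD !adjm_tens adjm_hat_Fmx adjm_eps adjm1 IH addbC.
Qed.

(** x' is the image of x under the antilinear anti-automorphism F_ij -> F_ji. Built along [Find]
    inside one representation, it does not require checking that this map respects the relations. *)
Lemma rho_adj n x : exists x', rho n x' = adjm (rho n x).
Proof.
elim/Find: x => [|x y [x' xE] [y' yE]|k x [x' xE]|i j x [x' xE]].
- by exists 1; rewrite rho1 adjm1.
- by exists (x' + y'); rewrite !linearD xE yE adjmD.
- by exists (k^* *: x'); rewrite !linearZ /= xE adjmZ.
- by exists (x' * F j i); rewrite !rhoM xE adjmM adjm_rhoF.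
Qed.

(** The standard basis of W^(x)n consists of weight vectors: m counts the tensor factors with index
    i or -i. *)
Lemma rho_Fdiag n (i : 'I_N) : exists m : 'I_(tdim N n) -> nat,
  rho n (F (ipos i) (ipos i)) = diag_mx (\row_k (m k)%:R) /\ forall k, (m k <= n)%N.
Proof.
elim: n => [|n [m [mE mn]]].
  exists (fun=> 0%N); split=> //; rewrite rhoF0; apply/matrixP => a b.
  by rewrite !mxE mul0rn.
pose h (a : 'I_(N + N + 1)) := (a == lshift 1 (ipos i)) || (a == lshift 1 (iopp (ipos i))).
exists (fun k => h (mxtens_unindex k).1 + m (mxtens_unindex k).2)%N; split; last first.
  by move=> k; apply: (leq_add (leq_b1 _) (mn _)).
rewrite rhoFS addbb [eps _ _ _]/= mE; apply/matrixP => k l.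
case: (mxtens_indexP k) => a b; case: (mxtens_indexP l) => a' b'.
rewrite [LHS]mxE !tensmxE.
 have -> : hat (Fmx C (ipos i) (ipos i)) a a' = (h a)%:R *+ (a == a').
  rewrite /hat /h; case: (split_ordP a) => c ->; case: (split_ordP a') => c' ->.
  - rewrite block_mxEul !mxE !eq_lshift.
    case: (c =P ipos i) => [->|] /=.
      rewrite [_ == iopp _]eq_sym iopp_neq addr0 eq_sym.
      by case: (c' == _).
    rewrite add0r; case: (c =P _) => [->|] _ /=; last by rewrite mul0rn.
    by congr (1 *+ nat_of_bool _); apply: eq_sym.
  - by rewrite block_mxEur mxE eq_lrshift.
  - by rewrite block_mxEdl mxE !eq_rlshift.
  - by rewrite block_mxEdr mxE !eq_rlshift mul0rn.
rewrite !mxE !mxtens_indexK (can_eq (@mxtens_indexK _ _)) xpair_eqE.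
by case: (a == a'); case: (b == b');
  rewrite /= ?mulr1n ?mulr0n ?mulr1 ?mulr0 ?mul0r ?mul1r ?addr0 ?natrD.
Qed.

Definition weight_vec n (lam : 'I_N -> C) (w : 'cV[C]_(tdim N n)) :=
  forall i, rho n (F (ipos i) (ipos i)) *m w = lam i *: w.

Lemma weight_nat n lam (w : 'cV_(tdim N n)) : w != 0 -> weight_vec lam w ->
  exists l : 'I_N -> nat, forall i, lam i = (l i)%:R /\ (l i <= n)%N.
Proof.
move=> w0 wlam.
have [q wq] : exists q, w q ord0 != 0.
  case/matrix0Pn: w0 => q [j]; rewrite ord1; by exists q.
suff H i : exists l : nat, lam i = l%:R /\ (l <= n)%N.
  by exists (fun i => projT1 (cid (H i))) => i; case: (cid (H i)).
have [m [mE mn]] := rho_Fdiag n i; exists (m q); split => //.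
have := congr1 (fun M : 'cV_ _ => M q ord0) (wlam i).
by rewrite mE mul_diag_mx !mxE => /(mulIf wq) ->.
Qed.

(** Induction on the support of s. If lam is the weight of a basis vector q in the support and s is
    not of weight lam, some F_ii - lam_i keeps s nonzero but removes q from the support. All vectors
    met stay in the submodule generated by s. *)
Lemma weight_exists n (s : 'cV_(tdim N n)) : s != 0 ->
  exists u lam, rho n u *m s != 0 /\ weight_vec lam (rho n u *m s).
Proof.
have [k] := ubnP #|[set q | s q ord0 != 0]|; elim: k s => // k IH s sk s0.
have [q sq] : exists q, s q ord0 != 0.
  case/matrix0Pn: (s0) => q [j]; rewrite ord1; by exists q.
pose lam i := rho n (F (ipos i) (ipos i)) q q.
have [sw|] := EM (weight_vec lam s).
  by exists 1, lam; rewrite rho1 mul1mx.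
move/existsNP => [i /eqP ne].
pose t := rho n (F (ipos i) (ipos i) - (lam i)%:A) *m s.
have tE : t = rho n (F (ipos i) (ipos i)) *m s - lam i *: s.
  by rewrite /t linearB linearZ /= rho1 mulmxBl -scalemxAl mul1mx.
have t0 : t != 0 by rewrite tE subr_eq0.
have [|u [mu [us umu]]] := IH t _ t0.
  rewrite -ltnS; apply: leq_trans sk; rewrite ltnS; apply: proper_card.
  have [m [mE _]] := rho_Fdiag n i.
  apply/properP; split.
    apply/subsetP => j; rewrite !inE tE mE mul_diag_mx !mxE.
    by apply: contraNneq => ->; rewrite !mulr0 subr0.
  exists q; rewrite !inE // negbK tE /lam mE mul_diag_mx !mxE eqxx mulr1n.
  by rewrite subrr.
by exists (u * (F (ipos i) (ipos i) - (lam i)%:A)), mu; rewrite rhoM -mulmxA.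
Qed.

(** The zero vector is allowed; non-vanishing is stated separately where it matters. *)
Definition hw_vec n (lam : 'I_N -> C) (w : 'cV[C]_(tdim N n)) :=
  weight_vec lam w /\ forall i j : 'I_N, (i < j)%N ->
    rho n (F (ipos i) (ipos j)) *m w = 0 /\ rho n (F (ipos i) (iopp (ipos j))) *m w = 0.

Lemma Fweight (k i j : 'I_N) b (l := if b then iopp (ipos j) else ipos j) :
  F (ipos k) (ipos k) * F (ipos i) l =
  F (ipos i) l * F (ipos k) (ipos k) + ((k == i)%:R - (k == j)%:R) *: F (ipos i) l.
Proof.
rewrite Fbracket /Fsign addbb /= scale1r; congr (_ + _).
rewrite scalerBl scale1r.
have -> : (ipos k == ipos i) = (k == i) by rewrite /ipos eq_lshift.
have -> : (iopp (ipos k) == ipos i) = false.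
  by apply/negP => /eqP/(congr1 (@ipar N)); rewrite ipar_opp !ipar_ipos.
rewrite scale0r addr0; congr (_ - _); first by case: eqP => [->|]; rewrite ?scale0r.
rewrite /l; case: b l => _.
  rewrite ioppK; have -> : (iopp (ipos j) == ipos k) = false.
    by apply/negP => /eqP/(congr1 (@ipar N)); rewrite ipar_opp !ipar_ipos.
  rewrite scale0r add0r /ipos eq_lshift eq_sym; case: eqP => [->|]; last by rewrite !scale0r.
  by rewrite -[in LHS]Fopp ioppK.
have -> : (iopp (ipos j) == ipos k) = false.
  by apply/negP => /eqP/(congr1 (@ipar N)); rewrite ipar_opp !ipar_ipos.
by rewrite scale0r addr0 /ipos eq_lshift eq_sym; case: eqP => [->|]; rewrite ?scale0r.
Qed.

Lemma hw_exists n (s : 'cV_(tdim N n)) : s != 0 ->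
  exists u lam, rho n u *m s != 0 /\ hw_vec lam (rho n u *m s).
Proof.
move=> /weight_exists[u [lam [us0 wus]]].
suff H (w : 'cV_(tdim N n)) mu : w != 0 -> weight_vec mu w ->
    exists u lam, rho n u *m w != 0 /\ hw_vec lam (rho n u *m w).
  have [v [mu [v0 wv]]] := H _ _ us0 wus.
  by exists (v * u), mu; rewrite rhoM -mulmxA.
(* A raising operator adds e_i - e_j with i < j to the weight, so this height grows by j - i.
   Weights in W^(x)n have entries at most n, hence height at most B, and m below bounds the number
   of raisings left. *)
pose ht (l : 'I_N -> nat) := (\sum_(k < N) (N - k) * l k)%N.
pose B := (\sum_(k < N) (N - k) * n)%N.
suff H2 m (l : 'I_N -> nat) (x : 'cV_(tdim N n)) : (B < ht l + m)%N -> x != 0 ->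
    weight_vec (fun i => (l i)%:R) x ->
    exists u lam, rho n u *m x != 0 /\ hw_vec lam (rho n u *m x).
  move=> w0 wmu; have [l lE] := weight_nat w0 wmu.
  apply: (H2 B.+1 l) => //; first by rewrite addnS ltnS leq_addl.
  by move=> i; rewrite wmu; case: (lE i) => ->.
elim: m l x => [|m IH] l x Bl x0 wx.
  have [l' lE] := weight_nat x0 wx.
  suff : (ht l <= B)%N by rewrite leqNgt; move: Bl; rewrite addn0 => ->.
  apply: leq_sum => k _; rewrite leq_mul2l; case: (lE k) => /eqP.
  by rewrite eqr_nat => /eqP -> ->; rewrite orbT.
have [hw|] := EM (hw_vec (fun i => (l i)%:R) x).
  by exists 1, (fun i => (l i)%:R); rewrite rho1 mul1mx.
move=> nhw.
have [i [j [b [ij ex0]]]] : exists (i j : 'I_N) b, (i < j)%N /\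
    rho n (F (ipos i) (if b then iopp (ipos j) else ipos j)) *m x != 0.
  apply: contrapT => /forallNP H; apply: nhw; split=> // i j ij.
  move/forallNP: (H i) => /(_ j)/forallNP Hij.
  by split; apply/eqP; apply: contrapT => /negP ne;
    [apply: (Hij false) | apply: (Hij true)].
pose e := F (ipos i) (if b then iopp (ipos j) else ipos j).
pose nu k : C := (l k)%:R + ((k == i)%:R - (k == j)%:R).
have we : weight_vec nu (rho n e *m x).
  move=> k; rewrite mulmxA -rhoM Fweight linearD linearZ /= rhoM mulmxDl -mulmxA wx.
  by rewrite -scalemxAr -scalemxAl -scalerDl.
have [l' lE] := weight_nat ex0 we.
have [||u' [lam' [u0 hu]]] := IH l' _ _ ex0.
- suff : (ht l < ht l')%N by move=> hl; apply: leq_trans Bl _; rewrite addnS -addSn leq_add2r.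
  have : (ht l')%:R + (N - j)%:R = (ht l)%:R + (N - i)%:R :> C.
    rewrite !natr_sum.
    have E (k : 'I_N) : ((N - k) * l' k)%:R =
        ((N - k) * l k)%:R + (N - k)%:R * ((k == i)%:R - (k == j)%:R) :> C.
      by case: (lE k) => nuE _; rewrite natrM -nuE /nu mulrDr -natrM.
    rewrite (eq_bigr _ (fun k _ => E k)) big_split /= -addrA; congr (_ + _).
    have S (q : 'I_N) : \sum_(k < N) (N - k)%:R * (k == q)%:R = (N - q)%:R :> C.
      rewrite (bigD1 q) //= eqxx mulr1 big1 ?addr0 // => k /negbTE ->.
      by rewrite mulr0.
    under eq_bigr do rewrite mulrBr.
    by rewrite sumrB !S subrK.
  move/eqP; rewrite -!natrD eqr_nat => /eqP hE.
  rewrite -(ltn_add2r (N - j)) hE ltn_add2l.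
  exact: ltn_sub2l (ltn_ord i) ij.
- by move=> k; rewrite we; case: (lE k) => ->.
by exists (u' * e), lam'; rewrite rhoM -mulmxA.
Qed.

Hypothesis rho_faithful : forall x, (forall n, rho n x = 0) -> x = 0.

(* If s = X v is not zero, then the submodule it generates contains a highest
   weight vector w = X v'; X is normal, as it is central, and kills w, hence so
   does its adjoint, and w is orthogonal to the image of X. *)
Lemma central_vanish X : (forall y, X * y = y * X) ->
  (forall n lam w, hw_vec lam w -> rho n X *m w = 0) -> X = 0.
Proof.
move=> XC Xhw; apply: rho_faithful => n; apply/eqP; apply: contrapT => /negP/eqP X0.
have [v s0] : exists v : 'cV_(tdim N n), rho n X *m v != 0.
  have /matrix0Pn[i [j Xij]] : rho n X != 0 by apply/eqP.
  exists (delta_mx j ord0); apply: contraNneq Xij => /(congr1 (fun M : 'cV_ _ => M i ord0)).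
  by rewrite -colE !mxE => ->.
have [u [lam [w0 hw]]] := hw_exists s0.
set w := rho n u *m _ in w0 hw.
have wE : w = rho n X *m (rho n u *m v) by rewrite /w !mulmxA -!rhoM XC.
have [X' X'E] := rho_adj n X.
have t0 : adjm (rho n X) *m w = 0.
  apply: adjm_mul_eq0; rewrite adjmM adjmK -mulmxA [rho n X *m (_ *m _)]mulmxA -X'E.
  by rewrite -rhoM XC rhoM -mulmxA (Xhw _ _ _ hw) !mulmx0.
case/eqP: w0; apply: adjm_mul_eq0.
by rewrite [X in adjm X]wE adjmM -mulmxA t0 mulmx0.
Qed.

End HighestWeight.

(** * Cyclic elements *)

Section Cyclic.
Variables (K : fieldType) (N : nat).
Local Notation idx := 'I_(N + N).
Variables (U : algType K) (F : idx -> idx -> U).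

Hypothesis Fopp : forall i j, F (iopp i) (iopp j) = F i j.
Hypothesis Fbracket : queer_bracket F.

Local Notation sg b := ((-1) ^+ (nat_of_bool b) : K).
Local Notation Fsg := (Fsign K).

(* The matrix X transforms under the adjoint action as the matrix F does. *)
Definition tensorial (X : idx -> idx -> U) := forall i j k l : idx,
  F i j * X k l = Fsg i j k l *: (X k l * F i j) +
  ((j == k)%:R *: X i l + (iopp j == k)%:R *: X (iopp i) l
   - Fsg i j k l *: ((l == i)%:R *: X k j + (l == iopp i)%:R *: X k (iopp j))).

(** The sign of the inner index is the one in the cyclic elements; with it, tensorial matrices are
    closed under products. *)
Definition sgn_mul (X Y : idx -> idx -> U) (k l : idx) : U :=
  \sum_m sg (ipar m) *: (X k m * Y m l).

Lemma tensorialF : tensorial F.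
Proof.
move=> i j k l; rewrite Fbracket.
suff -> : F (iopp k) j = F k (iopp j) by rewrite (ioppE l i).
by rewrite -[LHS]Fopp ioppK.
Qed.

Lemma sum_delta (V : lmodType K) (G : idx -> V) (m : idx) :
  \sum_k (k == m)%:R *: G k = G m.
Proof.
rewrite (bigD1 m) //= eqxx scale1r big1 ?addr0 // => k /negbTE ->.
by rewrite scale0r.
Qed.

Lemma Fsign_mul (i j k l m : idx) : Fsg i j k m * Fsg i j m l = Fsg i j k l.
Proof.
rewrite /Fsign -signr_addb; congr (_ ^+ nat_of_bool _).
by case: (ipar i); case: (ipar j); case: (ipar k); case: (ipar l); case: (ipar m).
Qed.

Lemma Fsign_shift (i j k : idx) :
  sg (ipar i) * Fsg i j k i = sg (ipar j) * Fsg i j k j.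
Proof.
rewrite /Fsign -!signr_addb; congr (_ ^+ nat_of_bool _).
by case: (ipar i); case: (ipar j); case: (ipar k).
Qed.

Lemma Fsign_shift_opp (i j k : idx) :
  sg (ipar (iopp i)) * Fsg i j k (iopp i) = sg (ipar (iopp j)) * Fsg i j k (iopp j).
Proof.
rewrite /Fsign -!signr_addb !ipar_opp; congr (_ ^+ nat_of_bool _).
by case: (ipar i); case: (ipar j); case: (ipar k).
Qed.

Lemma tensorial_mul X Y : tensorial X -> tensorial Y -> tensorial (sgn_mul X Y).
Proof.
move=> tX tY i j k l.
pose A m := (j == k)%:R *: X i m + (iopp j == k)%:R *: X (iopp i) m.
pose A' m := (m == i)%:R *: X k j + (m == iopp i)%:R *: X k (iopp j).
pose B m := (j == m)%:R *: Y i l + (iopp j == m)%:R *: Y (iopp i) l.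
pose B' m := (l == i)%:R *: Y m j + (l == iopp i)%:R *: Y m (iopp j).
have E m : F i j * (sg (ipar m) *: (X k m * Y m l)) =
    Fsg i j k l *: (sg (ipar m) *: (X k m * Y m l) * F i j)
    + (sg (ipar m) *: (A m * Y m l) - Fsg i j k l *: (sg (ipar m) *: (X k m * B' m)))
    + ((sg (ipar m) * Fsg i j k m) *: (X k m * B m) - (sg (ipar m) * Fsg i j k m) *: (A' m * Y m l)).
  rewrite -scalerAr mulrA tX mulrDl -scalerAl -mulrA tY -/(A m) -/(A' m) -/(B m) -/(B' m).
  rewrite mulrDr mulrBr mulrBl -!scalerAr -!scalerAl !scalerDr !scalerN !scalerA -!mulrA.
  rewrite Fsign_mul !mulrA [Fsg i j k l * sg _]mulrC -(Fsign_mul i j k l m).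
  rewrite !mulrA -!addrA; congr (_ + _).
  by rewrite addrCA [RHS]addrCA; congr (_ + _); rewrite addrCA.
rewrite {1}/sgn_mul mulr_sumr (eq_bigr _ (fun m _ => E m)) !big_split /=.
rewrite -scaler_sumr -mulr_suml -/(sgn_mul X Y k l) -addrA; congr (_ + _).
(* The terms in which F_ij acts on the contracted index m cancel in the sum: those at m = j, -j from
   Y match those at m = i, -i from X, with equal signs by [Fsign_shift] and [Fsign_shift_opp]. *)
rewrite [X in _ + X](_ : _ = 0) ?addr0.
  rewrite sumrN -scaler_sumr; congr (_ - _ *: _).
    rewrite /A /sgn_mul !scaler_sumr -big_split; apply: eq_bigr => m _.
    by rewrite mulrDl scalerDr -!scalerAl !scalerA ![sg _ * _%:R]mulrC.
  rewrite /B' /sgn_mul !scaler_sumr -big_split; apply: eq_bigr => m _.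
  by rewrite mulrDr scalerDr -!scalerAr !scalerA ![sg _ * _%:R]mulrC.
rewrite sumrN; apply/eqP; rewrite subr_eq0; apply/eqP.
pose c m := sg (ipar m) * Fsg i j k m.
transitivity (\sum_m ((m == j)%:R *: (c m *: (X k m * Y i l)) +
                      (m == iopp j)%:R *: (c m *: (X k m * Y (iopp i) l)))).
  apply: eq_bigr => m _; rewrite /B mulrDr scalerDr -!scalerAr !scalerA.
  by rewrite ![c m * _]mulrC ![_ == m]eq_sym.
transitivity (\sum_m ((m == i)%:R *: (c m *: (X k j * Y m l)) +
                      (m == iopp i)%:R *: (c m *: (X k (iopp j) * Y m l)))); last first.
  apply: eq_bigr => m _; rewrite /A' mulrDl scalerDr -!scalerAl !scalerA.
  by rewrite ![c m * _]mulrC.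
by rewrite !big_split /= !sum_delta /c Fsign_shift Fsign_shift_opp.
Qed.

(* cyc m is the power of exponent m.+1 of the matrix F. *)
Fixpoint cyc (m : nat) : idx -> idx -> U :=
  if m is m'.+1 then sgn_mul F (cyc m') else F.

Lemma tensorial_cyc m : tensorial (cyc m).
Proof. by elim: m => [|m IH]; [exact: tensorialF | apply: tensorial_mul IH; exact: tensorialF]. Qed.

(** Each of the m contracted indices changes its sign under k -> -k. For m odd the diagonal entries
    at k and -k cancel, so the cyclic elements of even index vanish. *)
Lemma cyc_opp m i j : cyc m (iopp i) (iopp j) = (-1) ^+ m *: cyc m i j.
Proof.
elim: m i j => [|m IH] i j /=; first by rewrite Fopp scale1r.
rewrite /sgn_mul (reindex_inj (inv_inj (@ioppK N))) /= scaler_sumr.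
apply: eq_bigr => k _; rewrite Fopp IH ipar_opp -scalerAr !scalerA.
rewrite exprS mulrC; case: (ipar k);
  by rewrite /= ?expr0 ?expr1 ?mulr1 ?mulN1r ?mulrN1 ?opprK ?mulrNN ?mulNr.
Qed.

Lemma cyc_trace_central m i j :
  F i j * \sum_k cyc m k k = (\sum_k cyc m k k) * F i j.
Proof.
rewrite mulr_sumr mulr_suml; apply/eqP; rewrite -subr_eq0 -sumrB.
pose X := cyc m.
have E k : F i j * X k k - X k k * F i j =
    (k == j)%:R *: X i k + (k == iopp j)%:R *: X (iopp i) k
    - ((k == i)%:R *: X k j + (k == iopp i)%:R *: X k (iopp j)).
  rewrite tensorial_cyc /Fsign addbb andbF expr0 !scale1r addrC addKr.
  by rewrite [j == k]eq_sym [iopp j == k]eq_sym.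
rewrite (eq_bigr _ (fun k _ => E k)) sumrB !big_split /= !sum_delta.
by rewrite subrr.
Qed.

Definition fcons (T : finType) r (a : T) (g : {ffun 'I_r -> T}) : {ffun 'I_r.+1 -> T} :=
  [ffun k => if unlift ord0 k is Some j then g j else a].

Lemma fcons0 (T : finType) r (a : T) (g : {ffun 'I_r -> T}) : fcons a g ord0 = a.
Proof. by rewrite ffunE unlift_none. Qed.

Lemma fconsS (T : finType) r (a : T) (g : {ffun 'I_r -> T}) k :
  fcons a g (lift ord0 k) = g k.
Proof. by rewrite ffunE liftK. Qed.

Lemma sum_fcons (T : finType) r (V : nmodType) (G : {ffun 'I_r.+1 -> T} -> V) :
  \sum_f G f = \sum_a \sum_(g : {ffun 'I_r -> T}) G (fcons a g).
Proof.
rewrite pair_big /= (reindex (fun p : T * {ffun 'I_r -> T} => fcons p.1 p.2)) //=.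
exists (fun f => (f ord0, [ffun k => f (lift ord0 k)])) => [[a g] _ | f _] /=.
  by congr (_, _); rewrite ?fcons0 //; apply/ffunP => k; rewrite ffunE fconsS.
apply/ffunP => k; rewrite ffunE; case: unliftP => [j ->|->] //.
by rewrite ffunE.
Qed.

(** Successor along an open path that ends in b. When b is the first entry, the path closes up and
    this becomes the cyclic [ordS]. *)
Definition vnext (T : Type) r (b : T) (f : 'I_r.+1 -> T) (k : 'I_r.+1) : T :=
  if insub k.+1 is Some j then f j else b.

Lemma vnext_cons0 (T : finType) r (a b : T) (g : {ffun 'I_r.+1 -> T}) :
  vnext b (fcons a g) ord0 = g ord0.
Proof.
rewrite /vnext; case: insubP => [j _ jE|//].
by rewrite (_ : j = lift ord0 ord0) ?fconsS //; apply: val_inj.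
Qed.

Lemma vnext_consS (T : finType) r (a b : T) (g : {ffun 'I_r.+1 -> T}) k :
  vnext b (fcons a g) (lift ord0 k) = vnext b g k.
Proof.
rewrite /vnext lift0; case: insubP => [j jr jE|njr]; case: insubP => [i ir iE|nir] //=.
- by rewrite (_ : j = lift ord0 i) ?fconsS //; apply: val_inj; rewrite /= jE iE.
- by move: nir; rewrite -ltnS jr.
- by move: njr; rewrite ltnS ir.
Qed.

Lemma cyc_sum r a b : cyc r a b = \sum_(g : {ffun 'I_r -> idx})
  (-1) ^+ (\sum_(k < r) ipar (g k))%N *:
  \prod_(k < r.+1) F (fcons a g k) (vnext b (fcons a g) k).
Proof.
elim: r a => [|r IH] a.
  rewrite (eq_bigr (fun=> F a b)) => [|g _]; last first.
    rewrite big_ord0 scale1r big_ord1 fcons0 /vnext.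
    by case: insubP.
  by rewrite sumr_const card_ffun !card_ord expn0.
rewrite [LHS]/= /sgn_mul sum_fcons; apply: eq_bigr => x _; rewrite IH mulr_sumr scaler_sumr.
apply: eq_bigr => h _.
have SE : (\sum_(k < r.+1) ipar (fcons x h k) = ipar x + \sum_(k < r) ipar (h k))%N.
  by rewrite big_ord_recl fcons0; congr (_ + _)%N; apply: eq_bigr => k _; rewrite fconsS.
rewrite SE exprD -scalerA -scalerAr; congr (_ *: _).
congr (_ *: _); rewrite [RHS]big_ord_recl fcons0 vnext_cons0 fcons0; congr (_ * _).
by apply: eq_bigr => k _; rewrite fconsS vnext_consS.
Qed.

Lemma cyc_trace r : \sum_a cyc r a a = \sum_(f : {ffun 'I_r.+1 -> idx})
  (-1) ^+ (\sum_(k < r.+1 | (0 < k)%N) ipar (f k))%N *: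
  \prod_(k < r.+1) F (f k) (f (ordS k)).
Proof.
rewrite sum_fcons; apply: eq_bigr => a _; rewrite cyc_sum; apply: eq_bigr => g _.
have SE : (\sum_(k < r.+1 | (0 < k)%N) ipar (fcons a g k) = \sum_(k < r) ipar (g k))%N.
  rewrite big_mkcond big_ord_recl; transitivity (0 + \sum_(k < r) ipar (g k))%N => //.
  congr (_ + _)%N => //.
  by apply: eq_bigr => k _; rewrite fconsS.
rewrite SE; congr (_ *: _); apply: eq_bigr => k _; congr F; rewrite /vnext.
case: insubP => [j jr jE|]; last rewrite -leqNgt => kr.
  by congr (fcons a g _); apply: val_inj; rewrite /= jE modn_small.
have -> : ordS k = ord0; last by rewrite fcons0.
apply: val_inj => /=; have /eqP -> : (k.+1 == r.+1) by rewrite eqn_leq kr ltn_ord.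
by rewrite modnn.
Qed.

(** * Powers of the matrix F on a highest weight vector *)

Section HighestWeightVector.
Variables (d : nat) (rho : {linear U -> 'M[K]_d}).
Hypothesis rhoM : forall x y, rho (x * y) = rho x *m rho y.
Variables (w : 'cV[K]_d) (lam : 'I_N -> K).
Local Notation act x := (rho x *m w).
Hypothesis w_weight : forall i, act (F (ipos i) (ipos i)) = lam i *: w.
Hypothesis w_hw : forall i j : 'I_N, (i < j)%N ->
  act (F (ipos i) (ipos j)) = 0 /\ act (F (ipos i) (iopp (ipos j))) = 0.

Lemma actD x y : act (x + y) = act x + act y.
Proof. by rewrite linearD mulmxDl. Qed.

Lemma actB x y : act (x - y) = act x - act y.
Proof. by rewrite linearB mulmxBl. Qed.

Lemma actZ k x : act (k *: x) = k *: act x.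
Proof. by rewrite linearZ /= scalemxAl. Qed.

Lemma act_sum (I : Type) (r : seq I) (P : pred I) (f : I -> U) :
  act (\sum_(i <- r | P i) f i) = \sum_(i <- r | P i) act (f i).
Proof. by rewrite linear_sum mulmx_suml. Qed.

Lemma actM x y : act (x * y) = rho x *m act y.
Proof. by rewrite rhoM mulmxA. Qed.

Definition absx (a : idx) : 'I_N := match split a with inl k => k | inr k => k end.

Lemma absx_pos i : absx (ipos i) = i.
Proof. by rewrite /absx /ipos -/(unsplit (inl i)) unsplitK. Qed.

Lemma absx_opp a : absx (iopp a) = absx a.
Proof.
case: (split_ordP a) => k ->; rewrite (iopp_ipos, iopp_ineg) /absx.
  by rewrite -/(unsplit (inr k)) -/(unsplit (inl k)) !unsplitK.
by rewrite -/(unsplit (inr k)) -/(unsplit (inl k)) !unsplitK.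
Qed.

Lemma absx_neq a b : (absx a < absx b)%N -> (b == a) = false /\ (b == iopp a) = false.
Proof.
by move=> ab; split; apply/negP => /eqP E; move: ab; rewrite E ?absx_opp ltnn.
Qed.

Lemma actF_lt a b : (absx a < absx b)%N -> act (F a b) = 0.
Proof.
have H (i : 'I_N) (b' : idx) : (i < absx b')%N -> act (F (ipos i) b') = 0.
  case: (iopp_cases b') => [] [j ->]; rewrite ?absx_opp absx_pos => ij.
    by have [] := w_hw ij.
  by have [] := w_hw ij.
case: (iopp_cases a) => [] [i ->]; rewrite ?absx_opp absx_pos => ij; first exact: H.
by rewrite -[b]ioppK Fopp; apply: H; rewrite absx_opp.
Qed.

(** In the term of inner index k, induction applies directly if |k| < |b|. Otherwise F_ak is moved
    to the right, where it kills w, and the only correction is [cyc m a b], again covered by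
    induction. *)
Lemma act_cyc_lt m a b : (absx a < absx b)%N -> act (cyc m a b) = 0.
Proof.
elim: m a b => [|m IH] a b ab; first exact: actF_lt.
rewrite /= act_sum big1 // => k _; rewrite actZ.
case: (ltnP (absx k) (absx b)) => [kb|bk]; first by rewrite actM IH // mulmx0 scaler0.
have [ba ba'] := absx_neq ab.
rewrite tensorial_cyc ba ba' !scale0r addr0 scaler0 subr0 eqxx scale1r iopp_neq scale0r addr0.
by rewrite actD actZ actM actF_lt ?(leq_trans ab) // mulmx0 scaler0 add0r IH // scaler0.
Qed.

Local Notation h i := (F (ipos i) (iopp (ipos i))).

Lemma act_cyc_step m (i : 'I_N) (b : idx) : absx b = i ->
  act (cyc m.+1 (ipos i) b) =
  rho (F (ipos i) (ipos i)) *m act (cyc m (ipos i) b)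
  - rho (h i) *m act (cyc m (iopp (ipos i)) b)
  + \sum_(l < N | (i < l)%N)
     (act (F (ipos i) (ipos l) * cyc m (ipos l) b)
      - act (F (ipos i) (iopp (ipos l)) * cyc m (iopp (ipos l)) b)).
Proof.
move=> bi; rewrite /= /sgn_mul act_sum sum_idx.
pose G l := act (F (ipos i) (ipos l) * cyc m (ipos l) b)
      - act (F (ipos i) (iopp (ipos l)) * cyc m (iopp (ipos l)) b).
have E l : act (sg (ipar (ipos l)) *: (F (ipos i) (ipos l) * cyc m (ipos l) b)) +
    act (sg (ipar (iopp (ipos l))) *: (F (ipos i) (iopp (ipos l)) * cyc m (iopp (ipos l)) b)) = G l.
  by rewrite !actZ ipar_opp ipar_ipos /= expr0 expr1 scale1r scaleN1r.
rewrite (eq_bigr _ (fun l _ => E l)) (bigD1 i) //= /G !actM; congr (_ + _).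
rewrite (bigID (fun l : 'I_N => (i < l)%N)) /= [X in _ + X]big1 ?addr0.
  by apply: eq_bigl => l; rewrite andb_idl // => il; rewrite -val_eqE gtn_eqF.
move=> l /andP[li]; rewrite -leqNgt leq_eqVlt val_eqE (negbTE li) /= => lti.
by rewrite !actM !act_cyc_lt ?absx_opp ?absx_pos ?bi // !mulmx0 subrr.
Qed.

Lemma act_F_cyc_gt m (i : 'I_N) (l : idx) b : absx b = i -> (i < absx l)%N ->
  act (F (ipos i) l * cyc m l b) = act (cyc m (ipos i) b)
   - Fsg (ipos i) l l b *: ((b == ipos i)%:R *: act (cyc m l l)
                            + (b == iopp (ipos i))%:R *: act (cyc m l (iopp l))).
Proof.
move=> bi il; rewrite tensorial_cyc eqxx iopp_neq scale1r scale0r addr0.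
rewrite actD actZ actM actF_lt ?absx_pos // mulmx0 scaler0 add0r.
by rewrite actB !actZ actD !actZ.
Qed.

(** For l > i, the copies of [cyc m (ipos i) (ipos i)] produced by l and -l cancel through the sign
    of the inner index. What remains are the entries at (l, l) and (-l, -l), in ratio (-1)^m: for m
    even this gives the entries - 2 lambda_l of T. *)
Lemma act_cyc_diag m (i : 'I_N) : act (cyc m.+1 (ipos i) (ipos i)) =
  rho (F (ipos i) (ipos i)) *m act (cyc m (ipos i) (ipos i))
  - rho (h i) *m act (cyc m (iopp (ipos i)) (ipos i))
  - \sum_(l < N | (i < l)%N) (1 + (-1) ^+ m) *: act (cyc m (ipos l) (ipos l)).
Proof.
rewrite act_cyc_step ?absx_pos // -sumrN; congr (_ + _); apply: eq_bigr => l il.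
rewrite !act_F_cyc_gt ?absx_opp ?absx_pos // eqxx [_ == iopp _]eq_sym iopp_neq.
rewrite !scale0r !addr0 !scale1r cyc_opp actZ /Fsign ipar_opp !ipar_ipos /= expr0 expr1.
by rewrite scale1r scaleN1r opprK opprD addrACA subrr add0r scalerDl scale1r opprD.
Qed.

Lemma act_cyc_off m (i : 'I_N) : act (cyc m.+1 (ipos i) (iopp (ipos i))) =
  rho (F (ipos i) (ipos i)) *m act (cyc m (ipos i) (iopp (ipos i)))
  - rho (h i) *m act (cyc m (iopp (ipos i)) (iopp (ipos i)))
  - \sum_(l < N | (i < l)%N) (1 - (-1) ^+ m) *: act (cyc m (ipos l) (iopp (ipos l))).
Proof.
rewrite act_cyc_step ?absx_opp ?absx_pos // -sumrN; congr (_ + _); apply: eq_bigr => l il.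
rewrite !act_F_cyc_gt ?absx_opp ?absx_pos // eqxx iopp_neq.
rewrite !scale0r !add0r !scale1r cyc_opp actZ.
rewrite /Fsign !ipar_opp !ipar_ipos /= expr0.
by rewrite !scale1r opprD opprK addrACA subrr add0r scalerBl scale1r opprB addrC.
Qed.

(* On a highest weight vector, the diagonal entries of the even powers of F act
   by scalars, and multiplication by F ^ 2 acts on these scalars by hw_mx. *)
Definition hw_mx : 'M[K]_N :=
  \matrix_(i, l) ((lam i ^+ 2 - lam i) *+ (i == l) - 2 * lam l *+ (i < l)%N).

Definition hw_coef (q : nat) : 'cV[K]_N := iter q (mulmx hw_mx) (const_mx 1).

Lemma hw_coefS q i : hw_coef q.+1 i ord0 =
  (lam i ^+ 2 - lam i) * hw_coef q i ord0
  - \sum_(l < N | (i < l)%N) 2 * lam l * hw_coef q l ord0.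
Proof.
rewrite /= mxE (eq_bigr (fun l => (lam i ^+ 2 - lam i) * hw_coef q l ord0 *+ (i == l)
   - 2 * lam l * hw_coef q l ord0 *+ (i < l)%N)) => [|l _]; last first.
  by rewrite mxE mulrBl -!mulrnAl.
rewrite sumrB [X in _ = _ - X]big_mkcond; congr (_ - _).
  rewrite (bigD1 i) //= eqxx mulr1n big1 ?addr0 // => l li.
  by rewrite eq_sym (negbTE li) mulr0n.
by apply: eq_bigr => l _; case: ifP; rewrite ?mulr1n ?mulr0n.
Qed.

Hypothesis two_neq0 : 2 != 0 :> K.

Lemma F_odd_square i : h i * h i = F (ipos i) (ipos i).
Proof.
have := Fbracket (ipos i) (iopp (ipos i)) (ipos i) (iopp (ipos i)).
rewrite /Fsign ipar_opp ipar_ipos /= expr1 !iopp_neq ioppK eqxx !scale0r !add0r !scale1r.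
rewrite !scaleN1r opprK Fopp => /eqP; rewrite addrC -subr_eq opprK -!mulr2n -!scaler_nat.
by rewrite -subr_eq0 -scalerBr scaler_eq0 (negbTE two_neq0) subr_eq0 => /eqP.
Qed.

Lemma F_odd_comm i : F (ipos i) (ipos i) * h i = h i * F (ipos i) (ipos i).
Proof.
rewrite Fbracket /Fsign addbb expr0 !scale1r !eqxx !iopp_neq ioppK !scale0r addr0 add0r.
by rewrite eqxx !scale1r -[F (iopp _) _]Fopp ioppK subrr addr0.
Qed.

(** The off-diagonal coefficient of h_i w has to be carried along: since h_i h_i = F_ii, it feeds -
    lambda_i back into the diagonal, which turns lambda_i^2 into the entry lambda_i^2 - lambda_i of
    T. *)
Lemma act_cyc q i :
  act (cyc q.*2 (ipos i) (ipos i)) = (lam i * hw_coef q i ord0) *: w /\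
  act (cyc q.*2 (ipos i) (iopp (ipos i))) = hw_coef q i ord0 *: act (h i).
Proof.
elim: q i => [|q IH] i; first by rewrite /= !mxE mulr1 scale1r w_weight.
pose a j := hw_coef q j ord0; pose a' j := hw_coef q.+1 j ord0.
have even_q : (-1) ^+ q.*2 = 1 :> K by rewrite -signr_odd odd_double.
have odd_q : (-1) ^+ q.*2.+1 = -1 :> K by rewrite exprS even_q mulr1.
(* The odd step in between performs the multiplication by T. Its off-diagonal entries kill w because
   F_jj commutes with h_j; the next step only multiplies by lambda_j or by h_j. *)
have E j : act (cyc q.*2.+1 (ipos j) (ipos j)) = a' j *: w /\
    act (cyc q.*2.+1 (ipos j) (iopp (ipos j))) = 0.
  have [Ed Eo] := IH j; split.
    rewrite act_cyc_diag Ed -[X in cyc _ (iopp _) X]ioppK cyc_opp even_q scale1r Eo.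
    rewrite -!scalemxAr w_weight -actM F_odd_square w_weight !scalerA.
    rewrite (eq_bigr (fun l => (2 * lam l * a l) *: w)) => [|l jl].
      rewrite -scaler_suml -!scalerBl /a' hw_coefS; congr ((_ - _) *: _).
      by ring.
    by have [-> _] := IH l; rewrite scalerA mulrA.
  rewrite act_cyc_off Eo cyc_opp even_q scale1r Ed -!scalemxAr -!actM F_odd_comm actM w_weight.
  rewrite -scalemxAr scalerA mulrC subrr sub0r big1 ?oppr0 // => l jl.
  by rewrite subrr scale0r.
have [Ed Eo] := E i; split.
  rewrite doubleS act_cyc_diag Ed -[X in cyc _ (iopp _) X]ioppK cyc_opp actZ.
  rewrite Eo scaler0 mulmx0 subr0.
  rewrite odd_q subrr big1 ?subr0; last by move=> l _; rewrite scale0r.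
  by rewrite -scalemxAr w_weight scalerA mulrC.
rewrite doubleS act_cyc_off Eo mulmx0 sub0r cyc_opp actZ odd_q Ed.
rewrite big1 ?subr0; last by move=> l _; have [_ ->] := E l; rewrite scaler0.
by rewrite scaleN1r mulmxN opprK -scalemxAr.
Qed.

Lemma act_cyc_trace q :
  act (\sum_k cyc q.*2 k k) = (2 * \sum_i lam i * hw_coef q i ord0) *: w.
Proof.
rewrite sum_idx act_sum mulr_sumr scaler_suml; apply: eq_bigr => i _.
rewrite actD cyc_opp -signr_odd odd_double scale1r; have [-> _] := act_cyc q i.
by rewrite -mulr2n -scaler_nat scalerA.
Qed.

End HighestWeightVector.

Lemma hw_coef_hankel lam p q :
  \sum_i lam i * hw_coef lam (p + q) i ord0 =
  \sum_i ((\row_i lam i) *m iter p (mulmx (hw_mx lam)) 1%:M) ord0 i * hw_coef lam q i ord0.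
Proof.
have iterE : hw_coef lam (p + q) = iter p (mulmx (hw_mx lam)) 1%:M *m hw_coef lam q.
  elim: p => [|p IH]; first by rewrite mul1mx.
  by rewrite addSn /= -mulmxA -IH.
have -> : \sum_i lam i * hw_coef lam (p + q) i ord0 =
    ((\row_i lam i) *m hw_coef lam (p + q)) ord0 ord0.
  by rewrite mxE; apply: eq_bigr => i _; rewrite mxE.
by rewrite iterE mulmxA mxE.
Qed.

End Cyclic.

Lemma det_mul_rect (K : fieldType) m n (A : 'M[K]_(m, n)) (B : 'M[K]_(n, m)) :
  (n < m)%N -> \det (A *m B) = 0.
Proof.
move=> nm; apply/eqP; apply: contraTT nm; rewrite -unitfE -leqNgt => uAB.
have : A *m B \in unitmx by rewrite unitmxE.
rewrite -row_full_unit => /eqP <-.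
exact: leq_trans (mxrankM_maxl _ _) (rank_leq_col _).
Qed.

(** * Action on highest weight vectors and the center *)

(** Over a noncommutative ring [\det] is the Leibniz sum with factors in the order of the rows, and
    every term commutes with y. *)
Lemma det_comm (A : nzRingType) k (M : 'M[A]_k) (y : A) :
  (forall i j, M i j * y = y * M i j) -> \det M * y = y * \det M.
Proof.
move=> My; apply/esym/commr_sum => s _; apply: commrM; first exact: commr_sign.
by apply: commr_prod => i _; apply/esym/My.
Qed.

Section ActScalar.
Variables (K : fieldType) (U : algType K) (d : nat) (rho : {linear U -> 'M[K]_d}).
Hypothesis rho1 : rho 1 = 1%:M.
Hypothesis rhoM : forall x y, rho (x * y) = rho x *m rho y.
Variable w : 'cV[K]_d.

Definition acts_by (x : U) (c : K) := rho x *m w = c *: w.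

Lemma acts_by0 : acts_by 0 0.
Proof. by rewrite /acts_by linear0 mul0mx scale0r. Qed.

Lemma acts_by1 : acts_by 1 1.
Proof. by rewrite /acts_by rho1 mul1mx scale1r. Qed.

Lemma acts_byD x y c e : acts_by x c -> acts_by y e -> acts_by (x + y) (c + e).
Proof. by rewrite /acts_by linearD mulmxDl scalerDl => -> ->. Qed.

Lemma acts_byZ k x c : acts_by x c -> acts_by (k *: x) (k * c).
Proof. by rewrite /acts_by linearZ /= -scalemxAl => ->; rewrite scalerA. Qed.

Lemma acts_byM x y c e : acts_by x c -> acts_by y e -> acts_by (x * y) (c * e).
Proof.
by rewrite /acts_by rhoM -mulmxA => xc ->; rewrite -scalemxAr xc scalerA mulrC.
Qed.

Lemma acts_by_sum (I : Type) (r : seq I) (P : pred I) (f : I -> U) (g : I -> K) :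
  (forall i, acts_by (f i) (g i)) ->
  acts_by (\sum_(i <- r | P i) f i) (\sum_(i <- r | P i) g i).
Proof.
move=> fg; apply: (big_ind2 acts_by) => //; first exact: acts_by0.
by move=> *; apply: acts_byD.
Qed.

Lemma acts_by_prod (I : Type) (r : seq I) (P : pred I) (f : I -> U) (g : I -> K) :
  (forall i, acts_by (f i) (g i)) ->
  acts_by (\prod_(i <- r | P i) f i) (\prod_(i <- r | P i) g i).
Proof.
move=> fg; apply: (big_ind2 acts_by) => //; first exact: acts_by1.
by move=> *; apply: acts_byM.
Qed.

Lemma acts_byX x c m : acts_by x c -> acts_by (x ^+ m) (c ^+ m).
Proof.
move=> xc; elim: m => [|m IH]; first exact: acts_by1.
by rewrite !exprS; apply: acts_byM.
Qed.

Lemma acts_by_det k (M : 'M[U]_k) (A : 'M[K]_k) :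
  (forall i j, acts_by (M i j) (A i j)) -> acts_by (\det M) (\det A).
Proof.
move=> MA; apply: acts_by_sum => s; apply: acts_byM; last exact: acts_by_prod.
have := acts_byZ ((-1) ^+ perm.odd_perm s) acts_by1; rewrite mulr1.
by case: (perm.odd_perm s); rewrite /= ?expr0 ?expr1 ?scale1r ?scaleN1r.
Qed.

Lemma acts_by_mmap N (f : 'I_N -> U) (lam : 'I_N -> K) (p : {mpoly K[N]}) :
  (forall i, acts_by (f i) (lam i)) -> acts_by (mpoly.mmap (fun k => k%:A) f p) p.@[lam].
Proof.
move=> flam; rewrite mevalE /mpoly.mmap; apply: acts_by_sum => m; apply: acts_byM.
  by rewrite -[X in acts_by _ X]mulr1; apply/acts_byZ/acts_by1.
by apply: acts_by_prod => i; apply: acts_byX.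
Qed.

End ActScalar.

Section HarishChandra.
Variables (C : numClosedFieldType) (N : nat).
Local Notation idx := 'I_(N + N).
Variables (U : algType C) (F : idx -> idx -> U).
Hypothesis Fopp : forall i j, F (iopp i) (iopp j) = F i j.
Variable rho : forall n, {linear U -> 'M[C]_(tdim N n)}.
Hypothesis rho1 : forall n, rho n 1 = 1%:M.
Hypothesis rhoM : forall n x y, rho n (x * y) = rho n x *m rho n y.
Hypothesis adjm_rhoF : forall n i j, adjm (rho n (F i j)) = rho n (F j i).

(** The vector v = z w - p(lambda) w is killed by n_+, because z commutes with it, and lies in n_- U
    w, because the U n_+ part kills w. In the product of v with itself, n_- moves across as its
    adjoint n_+, so v = 0 by positivity. *)
Lemma acts_by_HC (a b c d : 'I_N -> 'I_N -> U) z p n lam w :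
  (forall i j, F i j * z = z * F i j) ->
  z - mpoly.mmap (fun k => k%:A) (fun i => F (ipos i) (ipos i)) p =
    \sum_(i < N) \sum_(j < N | (j < i)%N)
          (F (ipos i) (ipos j) * a i j + F (ipos i) (iopp (ipos j)) * b i j)
      + \sum_(i < N) \sum_(j < N | (i < j)%N)
          (c i j * F (ipos i) (ipos j) + d i j * F (ipos i) (iopp (ipos j))) ->
  hw_vec F rho lam w -> acts_by (rho n) w z p.@[lam].
Proof.
move=> zC zE [ww hw].
have pw := acts_by_mmap (rho1 n) (rhoM n) p ww.
pose v := rho n z *m w - p.@[lam] *: w.
have kill x y : rho n (F x y) *m w = 0 -> rho n (F x y) *m v = 0.
  move=> xw; rewrite mulmxBr -scalemxAr xw scaler0 subr0 mulmxA -rhoM zC rhoM.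
  by rewrite -mulmxA xw mulmx0.
suff : v = 0 by move/eqP; rewrite subr_eq0 => /eqP.
apply: adjm_mul_eq0; rewrite {2}/v -pw -mulmxBl -linearB zE linearD mulmxDl !linear_sum /=.
rewrite mulmxDr !mulmx_suml !mulmx_sumr !big1 ?addr0 // => i _.
  rewrite linear_sum mulmx_suml mulmx_sumr big1 // => j ij.
  have [h1 h2] := hw _ _ ij.
  by rewrite linearD mulmxDl !rhoM -!mulmxA h1 h2 !mulmx0 addr0 mulmx0.
rewrite linear_sum mulmx_suml mulmx_sumr big1 // => j ji.
have [h1 h2] := hw _ _ ji.
have L x y : rho n (F y x) *m w = 0 -> adjm v *m rho n (F x y) = 0.
  by move=> yx; rewrite -[rho n (F x y)]adjm_rhoF -adjmM (kill y x) // adjm0.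
have h3 : rho n (F (iopp (ipos j)) (ipos i)) *m w = 0.
  by rewrite -[F _ _]Fopp ioppK.
by rewrite linearD mulmxDl !rhoM mulmxDr !mulmxA !L // !mul0mx addr0.
Qed.

End HarishChandra.

Section QueerCenter.
Variables (C : numClosedFieldType) (N : nat).
Local Notation U := (Uq C N).
Local Notation Q := (queer C N).
Local Notation F := (@Fgen C N).
Local Notation idx := 'I_(N + N).
Local Notation rho := (@rho C N).

Lemma Fgen_col (a b : idx) :
  F a b = \sum_(k < N) \sum_i Fmx C a b i (ipos k) *: F i (ipos k).
Proof. exact: iota_q_sum_col. Qed.

Lemma rho_F0 (i j : idx) : rho 0 (F i j) = 0.
Proof. by rewrite rho_F. Qed.

Lemma Urho_faithful (x : U) : (forall n, rho n x = 0) -> x = 0.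
Proof.
apply: (@rho_faithful _ _ _ _ (@Fgen_bracket C N) Fgen_col (@Uq_ind C N)
  (fun n => rho n) (@rho1 C N) (@rhoM C N) (@rho_FS C N)).
by move=> n; rewrite pnatr_eq0.
Qed.

Lemma Uadjm_rhoF n (i j : idx) : adjm (rho n (F i j)) = rho n (F j i).
Proof. exact: (adjm_rhoF (rho := fun n => rho n) rho_F0 (@rho_FS C N)). Qed.

Lemma queer_adjm (x : subvs_of Q) : adjm (vsval x) \in Q.
Proof.
by apply/queerP => i j; rewrite !adjmE; have /queerP -> := subvsP x.
Qed.

Lemma rho_iota_adjm n (x : subvs_of Q) :
  rho n (iota_q (Subvs (queer_adjm x))) = adjm (rho n (iota_q x)).
Proof.
have adjm_sum (I : Type) (r : seq I) (G : I -> 'M[C]_(tdim N n)) :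
    adjm (\sum_(i <- r) G i) = \sum_(i <- r) adjm (G i).
  exact: (big_morph (@adjm C _ _) (@adjmD C _ _) (@adjm0 C _ _)).
rewrite iota_q_sum_col iota_q_sum !rho_sum adjm_sum; apply: eq_bigr => k _.
rewrite !rho_sum adjm_sum; apply: eq_bigr => i _.
by rewrite !rhoZ adjmZ Uadjm_rhoF; congr (_ *: _); rewrite adjmE.
Qed.

Lemma gl_parity_adjm b (x : 'M[C]_(N + N)) : gl_parity b x -> gl_parity b (adjm x).
Proof.
move=> px i j; rewrite adjmE conjC_eq0 => /px; by rewrite addbC.
Qed.

Lemma Uparity_adj b (y : U) n : Uparity b y ->
  exists2 y', Uparity b y' & rho n y' = adjm (rho n y).
Proof.
elim=> {b y} [b||b x px|b x y _ [x' px xE] _ [y' py yE]|b k x _ [x' px xE]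
  |b c x y _ [x' px xE] _ [y' py yE]].
- exists 0; [exact: Uparity0 | by rewrite linear0 adjm0].
- exists 1; [exact: Uparity1 | by rewrite rho1 adjm1].
- exists (iota_q (Subvs (queer_adjm x))); last exact: rho_iota_adjm.
  exact/Uparity_gen/gl_parity_adjm.
- by exists (x' + y'); [exact: UparityD | rewrite !rhoD xE yE adjmD].
- by exists (k^* *: x'); [exact: UparityZ | rewrite !rhoZ xE adjmZ].
- exists (y' * x'); first by rewrite addbC; apply: UparityM.
  by rewrite !rhoM xE yE adjmM.
Qed.

(** The sum is the Gram matrix of A stacked on B. *)
Lemma adjm_mul_add_eq0 m n p (A : 'M[C]_(m, n)) (B : 'M[C]_(p, n)) :
  adjm A *m A + adjm B *m B = 0 -> A = 0.
Proof.
have adjm_col : adjm (col_mx A B) = row_mx (adjm A) (adjm B).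
  by rewrite /adjm map_col_mx tr_col_mx.
rewrite -mul_row_col -adjm_col => /adjm_mul_eq0/eqP.
by rewrite col_mx_eq0 => /andP[/eqP].
Qed.

(* z anticommutes with its adjoint, so z^* z + z z^* acts by 0. *)
Lemma supercentral_odd_eq0 (z : U) : Uparity true z ->
  (forall b y, Uparity b y -> z * y = (-1) ^+ b *: (y * z)) -> z = 0.
Proof.
move=> pz zC; apply: Urho_faithful => n.
have [z' pz' z'E] := Uparity_adj n pz.
apply: (@adjm_mul_add_eq0 _ _ _ _ (adjm (rho n z))); rewrite adjmK -z'E -!rhoM.
by rewrite (zC _ _ pz') expr1 scaleN1r -rhoD subrr linear0.
Qed.

Lemma Fcomm_comm (z y : U) : (forall i j, F i j * z = z * F i j) -> z * y = y * z.
Proof.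
move=> zC; elim/Uq_ind: y => [|x y xz yz|k x xz|i j x xz].
- by rewrite mul1r mulr1.
- by rewrite mulrDl mulrDr xz yz.
- by rewrite -scalerAl -scalerAr xz.
by rewrite mulrA -zC -mulrA xz mulrA.
Qed.

(** The odd component vanishes, so no sign remains and z commutes in the ordinary sense. *)
Lemma supercentral_comm (z y : U) : supercentral z -> z * y = y * z.
Proof.
case=> z0 [z1 [-> _ p1 zC]].
have -> : z1 = 0 by apply: supercentral_odd_eq0 p1 _ => b x /zC[].
rewrite addr0; apply: Fcomm_comm => i j.
have pF : Uparity (ipar i (+) ipar j) (F i j) by apply/Uparity_gen/Fmx_parity.
by have [-> _] := zC _ _ pF.
Qed.

Lemma Ucentral_vanish (X : U) : (forall y, X * y = y * X) ->
  (forall n lam w, hw_vec F (fun n => rho n) lam w -> acts_by (rho n) w X 0) -> X = 0.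
Proof.
move=> XC Xhw.
apply: (central_vanish (@Fgen_opp C N) (@Fgen_bracket C N) (@Uq_ind C N) (rho := fun n => rho n)
  (@rho1 C N) (@rhoM C N) rho_F0 (@rho_FS C N) Urho_faithful XC) => n lam w /Xhw.
by rewrite /acts_by scale0r.
Qed.

Lemma cyclic_eltE r : cyclic_elt C N r.+1 = \sum_k cyc F r k k.
Proof. exact/esym/(cyc_trace F). Qed.

Theorem cyclic_hankel r : (0 < r)%N ->
  \det (\matrix_(i < N.+1, j < N.+1) cyclic_elt C N (2 * (r + i + j) - 1)%N) = 0.
Proof.
case: r => // r _.
have idxE i j : (2 * (r.+1 + i + j) - 1 = ((r + i) + j).*2.+1)%N.
  by rewrite !addSn mul2n doubleS subn1.
apply: Ucentral_vanish => [y | n lam w hw].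
  apply: det_comm => i j; rewrite mxE idxE cyclic_eltE; apply: Fcomm_comm => a b.
  exact: (cyc_trace_central (@Fgen_opp C N) (@Fgen_bracket C N)).
(* Row i is 2 lambda^T T^(r+i) and column j of B is T^j (1, .., 1)^T. Here r is one less than in the
   statement, as c_(2q+1) corresponds to T^q. *)
pose A : 'M[C]_(N.+1, N) := \matrix_(i, k)
  (2 * ((\row_i lam i) *m iter (r + i) (mulmx (hw_mx lam)) 1%:M) ord0 k).
pose B : 'M[C]_(N, N.+1) := \matrix_(k, j) hw_coef lam j k ord0.
rewrite -(det_mul_rect A B (ltnSn N)); apply: acts_by_det; [exact: rho1 | exact: rhoM |].
move=> i j; rewrite mxE idxE cyclic_eltE /acts_by.
case: hw => ww hw.
rewrite (act_cyc_trace (@Fgen_opp C N) (@Fgen_bracket C N) (@rhoM C N n) ww hw) ?pnatr_eq0 //.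
rewrite hw_coef_hankel mulr_sumr [in RHS]mxE; congr (_ *: _).
by apply: eq_bigr => k _; rewrite !mxE mulrA.
Qed.

End QueerCenter.

(** * Stirling numbers *)

Fixpoint stir (n r : nat) : nat :=
  match n, r with
  | 0%N, 0%N => 1%N
  | n'.+1, r'.+1 => (stir n' r' + r'.+1 * stir n' r'.+1)%N
  | _, _ => 0%N
  end.

Lemma stir_small n r : (n < r)%N -> stir n r = 0%N.
Proof.
elim: n r => [|n IH] [|r] //=; rewrite ltnS => nr.
by rewrite !IH ?muln0 // ltnW.
Qed.

Section Falling.
Variable A : comNzRingType.
Implicit Type x : A.

Lemma falling0 x : falling x 0 = 1.
Proof. exact: big_ord0. Qed.

Lemma fallingSr x r : falling x r.+1 = falling x r * (x - r%:R).
Proof. exact: big_ord_recr. Qed.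

Lemma fallingSl x r : falling x r.+1 = x * falling (x - 1) r.
Proof.
rewrite /falling big_ord_recl subr0; congr (_ * _); apply: eq_bigr => i _.
by rewrite lift0 -natr1 opprD addrCA addrC.
Qed.

Lemma stir_falling n x : \sum_(r < n.+1) (stir n r)%:R * falling x r = x ^+ n.
Proof.
elim: n => [|n IH]; first by rewrite big_ord1 falling0 mul1r.
rewrite exprS -IH big_ord_recl mul0r add0r mulr_sumr.
rewrite (eq_bigr (fun r : 'I_n.+1 => (stir n r)%:R * falling x r.+1
    + (r.+1 * stir n r.+1)%N%:R * falling x r.+1)) => [|r _]; last first.
  by rewrite lift0 /= natrD mulrDl.
rewrite big_split /=.
rewrite [X in _ + X](_ : _ = \sum_(r < n.+1) (r * stir n r)%N%:R * falling x r).
  rewrite -big_split; apply: eq_bigr => r _.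
  by rewrite /= natrM fallingSr; ring.
rewrite [RHS]big_ord_recl mul0n mul0r add0r [LHS]big_ord_recr /= stir_small // muln0 mul0r addr0.
by apply: eq_bigr.
Qed.

(** Pulling x out of [falling x r.+1] leaves [falling (x - 1) r]. This yields the factor lambda_i
    and the node lambda_i - 1 of alpha_(m+1), hence the geometric dependence on m behind the Hankel
    factorization. *)
Lemma stir_falling_shift n x :
  \sum_(r < n.+1) (stir n r)%:R * falling x r.+1 = x * (x - 1) ^+ n.
Proof.
rewrite -stir_falling mulr_sumr; apply: eq_bigr => r _.
by rewrite fallingSl mulrCA.
Qed.

End Falling.

Lemma ffact_falling n r : (n ^_ r)%N%:R = falling n%:R r :> int.
Proof.
elim: r => [|r IH]; first by rewrite falling0 ffactn0.
rewrite ffactnSr natrM IH fallingSr.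
have [rn|nr] := leqP r n; first by rewrite natrB.
suff -> : falling (n%:R : int) r = 0 by rewrite !mul0r.
by rewrite -IH ffact_small.
Qed.

Lemma stir_ffact n x : (\sum_(r < n.+1) stir n r * x ^_ r)%N = (x ^ n)%N.
Proof.
have : (\sum_(r < n.+1) stir n r * x ^_ r)%N%:R = (x ^ n)%N%:R :> int.
  rewrite natr_sum natrX -stir_falling; apply: eq_bigr => r _.
  by rewrite natrM ffact_falling.
by move/eqP; rewrite eqr_nat => /eqP.
Qed.

Section CountPartition.
Variables (n x : nat) (P : {set {set 'I_n}}).
Hypothesis partP : partition P [set: 'I_n].

Let blk_in (i : 'I_n) : pblock P i \in P.
Proof. by apply: pblock_mem; rewrite (cover_partition partP). Qed.

Let blk (i : 'I_n) : {B | B \in P} := exist (fun B => B \in P) _ (blk_in i).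

Let blkE (B : {B | B \in P}) i : i \in val B -> blk i = B.
Proof.
move=> iB; apply: val_inj; apply: def_pblock (partition_trivIset partP) (valP B) iB.
Qed.

Let blkP (B : {B | B \in P}) : exists i, i \in val B.
Proof.
by apply/set0Pn; apply: contraTneq (valP B) => ->; rewrite (partition0 partP).
Qed.

(** A function whose fibres are the blocks of P is the same as an injection from the set of
    blocks. *)
Lemma card_preim_partition :
  #|[set f : {ffun 'I_n -> 'I_x} | preim_partition f [set: 'I_n] == P]| = (x ^_ #|P|)%N.
Proof.
pose phi (g : {ffun {B | B \in P} -> 'I_x}) : {ffun 'I_n -> 'I_x} := [ffun i => g (blk i)].
have phiI : injective phi.
  move=> g g' E; apply/ffunP => B; have [i iB] := blkP B.
  by have := congr1 (fun f : {ffun _ -> _} => f i) E; rewrite !ffunE (blkE iB).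
have -> : [set f : {ffun 'I_n -> 'I_x} | preim_partition f [set: 'I_n] == P] =
    phi @: [set g : {ffun {B | B \in P} -> 'I_x} | injectiveb g].
  apply/setP => f; rewrite inE; apply/eqP/imsetP => [fP | [g]].
    have eqvf : {in [set: 'I_n] & &, equivalence_rel [rel i j | f i == f j]}.
      by split => //= /eqP ->.
    have blkf i j : (j \in pblock P i) = (f i == f j).
      by rewrite -[in LHS]fP pblock_equivalence_partition.
    pose rep B := xchoose (blkP B).
    have repB B : rep B \in val B := xchooseP (blkP B).
    exists [ffun B => f (rep B)].
      rewrite inE; apply/injectiveP => B B'; rewrite !ffunE => /eqP.
      rewrite -blkf => H; rewrite -(blkE (repB B)) -(blkE (repB B')).
      by apply: val_inj; apply/esym/(same_pblock (partition_trivIset partP) H).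
    apply/ffunP => i; rewrite !ffunE; apply/eqP; rewrite -blkf.
    exact: (repB (blk i)).
  rewrite inE => /injectiveP gI ->; rewrite -[RHS](preim_partition_pblock partP).
  apply: eq_imset => i; apply/setP => j; rewrite !inE !ffunE (inj_eq gI).
  by rewrite -val_eqE.
by rewrite card_imset // card_inj_ffuns card_ord card_sig.
Qed.

End CountPartition.

(** All functions from n points to x points are sorted by their fibre partition, then by its number
    of blocks. *)
Lemma stirling2_ffact n x : (\sum_(r < n.+1) stirling2 n r * x ^_ r)%N = (x ^ n)%N.
Proof.
rewrite -[X in (X ^ n)%N](card_ord x) -[X in (_ ^ X)%N](card_ord n) -card_ffun -sum1_card.
rewrite (partition_big (fun f : {ffun 'I_n -> 'I_x} => preim_partition f [set: 'I_n])
  (fun P => partition P [set: 'I_n])) /= => [|f _]; last exact: preim_partitionP.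
rewrite (partition_big (fun P : {set {set 'I_n}} => inord #|P| : 'I_n.+1) xpredT) //=.
apply: eq_bigr => r _.
have cardP P : partition P [set: 'I_n] -> (#|P| < n.+1)%N.
  move=> pP; rewrite ltnS -[X in (_ <= X)%N](card_ord n) -cardsT.
  rewrite (card_partition pP) -sum1_card; apply: leq_sum => A AP.
  by rewrite card_gt0; apply: contraTneq AP => ->; rewrite (partition0 pP).
rewrite /stirling2 -sum1_card big_distrl /=; apply: eq_big => [P | P].
  rewrite inE; case pP: (partition P _) => //=.
  by rewrite -val_eqE /= inordK // cardP.
rewrite inE => /andP[pP /eqP <-]; rewrite mul1n -(card_preim_partition _ pP) sum1dep_card.
by apply: eq_card => f; rewrite !inE.
Qed.

(** Both families solve the same system, triangular in x. At x = r the terms above r vanish, those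
    below agree by induction, and r! cancels. *)
Lemma stirling2E n r : (r <= n)%N -> stirling2 n r = stir n r.
Proof.
have [m] := ubnP r; elim: m r => // m IH r; rewrite ltnS => rm rn.
have := stirling2_ffact n r; rewrite -(stir_ffact n r).
have rn1 : (r < n.+1)%N by rewrite ltnS.
rewrite (bigD1 (Ordinal rn1)) //= [RHS](bigD1 (Ordinal rn1)) //=.
have -> : (\sum_(i < n.+1 | i != Ordinal rn1) stirling2 n i * r ^_ i)%N =
          (\sum_(i < n.+1 | i != Ordinal rn1) stir n i * r ^_ i)%N.
  apply: eq_bigr => i; rewrite -val_eqE /= neq_ltn => /orP[ir|ri].
    by rewrite IH // ?(leq_trans ir) // -ltnS.
  by rewrite ffact_small // !muln0.
by move/addIn/eqP; rewrite ffactnn eqn_pmul2r ?fact_gt0 // => /eqP.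
Qed.

(** * Expansion of inverse falling factorials at infinity *)

Section InverseFalling.
Variable K : fieldType.

Definition trunc (M : nat) (a : nat -> K) : {poly K} := \poly_(i < M) a i.

(** The iterated [ser_mul] unfolds from its first factor, but the recurrence on r has to split off
    the last one; truncation to polynomials supplies the associativity. *)
Lemma ser_mul_prod M (r : nat) (a : nat -> nat -> K) n : (n < M)%N ->
  (\big[@ser_mul K/@ser_one K]_(k < r) a k) n = (\prod_(k < r) trunc M (a k))`_n.
Proof.
rewrite -(big_mkord xpredT a) -(big_mkord xpredT (fun k => trunc M (a k))).
elim: (index_iota 0 r) n => [|k s IH] n nM; first by rewrite !big_nil coef1.
rewrite !big_cons coefM /ser_mul; apply: eq_bigr => j _.
have jM : (j < M)%N by apply: leq_ltn_trans nM; rewrite -ltnS.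
by rewrite coef_poly jM IH // (leq_ltn_trans _ nM) // leq_subr.
Qed.

Lemma ser_inv_falling0 n : ser_inv_falling K 0 n = (n == 0%N)%:R.
Proof. by rewrite /ser_inv_falling big_ord0. Qed.

Lemma ser_inv_falling_const r : ser_inv_falling K r.+1 0 = 0.
Proof.
rewrite /ser_inv_falling (ser_mul_prod _ _ (ltnSn 0)) big_ord_recr coefM big_ord1.
by rewrite coef_poly mulr0.
Qed.

(** The coefficient of u^-n in u / (u falling r+1) = 1 / (u falling r) + r / (u falling r+1). *)
Lemma ser_inv_fallingS r n : ser_inv_falling K r.+1 n.+1 =
  ser_inv_falling K r n + r%:R * ser_inv_falling K r.+1 n.
Proof.
rewrite /ser_inv_falling !(@ser_mul_prod n.+2) // !big_ord_recr /=.
set p := \prod_(_ < r) _.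
rewrite !coefM big_ord_recr /= subnn coef_poly mulr0 addr0 big_ord_recr /=.
rewrite subSnn coef_poly /= expr0 mulr1 addrC; congr (_ + _).
rewrite [in RHS]big_ord_recr /= subnn coef_poly mulr0 addr0 mulr_sumr.
apply: eq_bigr => j _; have jn := ltn_ord j; rewrite !coef_poly.
rewrite subSn ?(ltnW jn) //= !ltnS (leq_trans (leq_subr _ _)) // -(subnSK jn) /=.
by rewrite ltnS leq_subr exprS mulrCA.
Qed.
Lemma ser_inv_falling_stir r n : ser_inv_falling K r.+1 n.+1 = (stir n r)%:R.
Proof.
elim: n r => [|n IH] r; rewrite ser_inv_fallingS.
  rewrite ser_inv_falling_const mulr0 addr0.
  by case: r => [|r]; rewrite ?ser_inv_falling0 ?ser_inv_falling_const.
rewrite IH; case: r => [|r]; first by rewrite ser_inv_falling0 mul0r addr0.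
by rewrite IH /= natrD natrM.
Qed.

End InverseFalling.

(** * One-row Capelli elements *)

Section Capelli.
Variables (C : numClosedFieldType) (N : nat).
Local Notation U := (Uq C N).
Local Notation F := (@Fgen C N).
Local Notation rho := (@rho C N).
Local Notation mp := {mpoly C[N]}.

Lemma capelli_coefS (D : nat -> U) m :
  capelli_coef D m.+1 = \sum_(i < m.+1) (stir m i)%:R *: D i.+1.
Proof.
rewrite /capelli_coef big_ord_recl ser_inv_falling0 scale0r add0r.
by apply: eq_bigr => i _; rewrite lift0 ser_inv_falling_stir.
Qed.

Lemma capelli_coef_stirling (D : nat -> U) n : (0 < n)%N ->
  capelli_coef D n = \sum_(1 <= j < n.+1) (D j *+ stirling2 (n - 1) (j - 1)).
Proof.
case: n => // m _; rewrite capelli_coefS big_add1 big_mkord; apply: eq_bigr => i _.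
have -> : stirling2 (m.+1 - 1) (i.+1 - 1) = stir m i.
  by rewrite !subn1 stirling2E // -ltnS; apply: ltn_ord.
exact: scaler_nat.
Qed.

(** The Harish-Chandra image of alpha_(m+1), when P r is that of D_r. *)
Definition qrow_coef (P : nat -> mp) (m : nat) : mp :=
  \sum_(i < m.+1) (stir m i)%:R *: P i.+1.

Lemma tofrac_qrow_coef (P : nat -> mp) m : (forall r, (0 < r)%N -> is_Qrow r (P r)) ->
  let x i : {fraction mp} := tofrac 'X_i in
  tofrac (qrow_coef P m) = \sum_(i < N)
    2 * \prod_(j < N | j != i) ((x i + x j) / (x i - x j)) * x i * (x i - 1) ^+ m.
Proof.
move=> PQ x; rewrite rmorph_sum /=.
rewrite (eq_bigr (fun k : 'I_m.+1 => \sum_(i < N)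
    2 * \prod_(j < N | j != i) ((x i + x j) / (x i - x j)) * ((stir m k)%:R * falling (x i) k.+1))).
  rewrite exchange_big; apply: eq_bigr => i _.
  by rewrite -mulr_sumr stir_falling_shift mulrA.
move=> k _; rewrite scaler_nat rmorphMn /= (PQ k.+1 isT) -mulr_natl !mulr_sumr.
by apply: eq_bigr => i _; rewrite -/(x i) /=; ring.
Qed.

(** In the field of rational functions the entries are power sums in the N nodes x_k - 1 with
    coefficients independent of i and j, so the matrix factors through dimension N; [tofrac] is
    injective. *)
Lemma qrow_hankel (P : nat -> mp) s : (forall r, (0 < r)%N -> is_Qrow r (P r)) ->
  \det (\matrix_(i < N.+1, j < N.+1) qrow_coef P (s + i + j)) = 0.
Proof.
move=> PQ; apply/eqP; rewrite -tofrac_eq0 -det_map_mx; apply/eqP.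
pose x i : {fraction mp} := tofrac 'X_i.
pose A : 'M_(N.+1, N) := \matrix_(i, k)
  (2 * \prod_(j < N | j != k) ((x k + x j) / (x k - x j)) * x k * (x k - 1) ^+ (s + i)).
pose B : 'M_(N, N.+1) := \matrix_(k, j) ((x k - 1) ^+ j).
rewrite -(det_mul_rect A B (ltnSn N)); congr (\det _); apply/matrixP => i j.
rewrite !mxE; apply: etrans (tofrac_qrow_coef _ PQ) _; apply: eq_bigr => k _.
by rewrite !mxE exprD mulrA.
Qed.

Theorem capelli_hankel (D : nat -> U) r : is_capelli D -> (0 < r)%N ->
  \det (\matrix_(i < N.+1, j < N.+1) capelli_coef D (r + i + j)%N) = 0.
Proof.
case: r => // s [_ DQ] _.
have [P PD] : exists P : nat -> mp, forall q, (0 < q)%N -> is_Qrow q (P q) /\ is_HC (D q) (P q).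
  have H q : exists p : mp, (0 < q)%N -> is_Qrow q p /\ is_HC (D q) p.
    (* A dummy value at q = 0: by [capelli_coefS], the coefficients of positive index only involve D
       q with q > 0. *)
    case: q => [|q]; first by exists 0.
    by have [_ [p pQ pD]] := DQ q.+1 isT; exists p.
  by exists (fun q => projT1 (cid (H q))) => q; case: (cid (H q)).
have DC q y : (0 < q)%N -> D q * y = y * D q.
  by move=> /DQ[Dq _]; apply: supercentral_comm.
have idx i j : (s.+1 + i + j = (s + i + j).+1)%N by rewrite !addSn.
apply: Ucentral_vanish => [y | n lam w hw].
  apply: det_comm => i j; rewrite mxE idx capelli_coefS mulr_suml mulr_sumr.
  by apply: eq_bigr => k _; rewrite -scalerAl -scalerAr DC.
pose A := \matrix_(i < N.+1, j < N.+1) qrow_coef P (s + i + j).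
(* The polynomial determinant is already zero, so evaluation is legitimate even at weights with
   equal entries. *)
have <- : \det (map_mx (mpoly.meval lam) A) = 0.
  by rewrite det_map_mx qrow_hankel ?rmorph0 // => q /PD[].
apply: acts_by_det; [exact: rho1 | exact: rhoM |] => i j.
have -> : map_mx (mpoly.meval lam) A i j =
    \sum_(k < (s + i + j).+1) (stir (s + i + j) k)%:R * (P k.+1).@[lam].
  by rewrite !mxE /qrow_coef raddf_sum; apply: eq_bigr => k _; apply: mevalZ.
rewrite mxE idx capelli_coefS.
apply: acts_by_sum => k; apply: acts_byZ.
have [_ [a [b [c [d zE]]]]] := PD k.+1 isT.
apply: (acts_by_HC (@Fgen_opp C N) (rho := fun n => rho n) (@rho1 C N) (@rhoM C N)
  (@Uadjm_rhoF C N) _ zE hw) => e f.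
by rewrite DC.
Qed.

End Capelli.

Theorem proposition5p2 (R : realType) (N : nat) (hN : (0 < N)%N) :
  (forall r : nat, (0 < r)%N ->
     \det (\matrix_(i < N.+1, j < N.+1)
             cyclic_elt R[i] N (2 * (r + i + j) - 1)%N) = 0) /\
  (forall D : nat -> Uq R[i] N, is_capelli D ->
     (forall n : nat, (0 < n)%N ->
        capelli_coef D n
          = \sum_(1 <= j < n.+1) (D j *+ stirling2 (n - 1) (j - 1))) /\
     (forall r : nat, (0 < r)%N ->
        \det (\matrix_(i < N.+1, j < N.+1) capelli_coef D (r + i + j)%N) = 0)).
Proof.
split=> [r|D capD]; first exact: cyclic_hankel.
by split=> n; [exact: capelli_coef_stirling | exact: capelli_hankel].
Qed.
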